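(* Let $\Phi_k\in\mathbb{R}^{p_0\times p_0}$ be any symmetric matrices with $\Phi_k\succeq0$, $k\in\mathbb{T}$. Then, for sequently generic $\{\mu_k,k\in\mathbb{T}\}$ and any initial pair $(t,z)$, Problem (MV) admits a unique open-loop self-coordination control for $(t,z)$ and $\{\Upsilon_k,k\in\mathbb{T}_t\}$, where $\Upsilon_k=\mu_k\begin{pmatrix}\Phi_k&-\Phi_k\\-\Phi_k&\Phi_k\end{pmatrix}$.
   Context: Let $N\ge1$, $\mathbb{T}=\{0,\dots,N-1\}$, $\mathbb{T}_t=\{t,\dots,N-1\}$; $\mathbb{R}_+=(0,+\infty)$; $m(\cdot)$ is Lebesgue measure; $\succeq0$ means nonnegative definite. Sequently generic: a property parameterized by $\{a_k\in\mathbb{R}_+,k\in\mathbb{T}\}$ is said to hold for sequently generic $\{a_k,k\in\mathbb{T}\}$ if it is satisfied for any $\{a_k,k\in\mathbb{T}\}$ with $a_{N-1}\in\mathbb{R}_+\setminus\overline\Lambda_{N-1}$, $a_{N-2}\in\mathbb{R}_+\setminus\overline\Lambda_{N-2}$, ..., $a_0\in\mathbb{R}_+\setminus\overline\Lambda_0$, where for each $k\in\mathbb{T}$, $m(\overline\Lambda_k)=0$ and $\overline\Lambda_k$ may depend on the values of $a_{k+1},\dots,a_{N-1}$. Market: $s_k>1$ ($k\in\mathbb{T}$) is the deterministic return of the riskless asset; $e_k=(e^1_k,\dots,e^{p_0}_k)^T$, $k\in\mathbb{T}$, are statistically independent random return vectors of $p_0$ risky assets with finite mean $\mathbb{E}e_k$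 and covariance $\mathrm{Cov}(e_k)\succeq0$. $\Theta_k=(e^1_k-s_k,\dots,e^{p_0}_k-s_k)^T$. $\mathbb{F}^m_k=\sigma(e_\ell,\ell=0,\dots,k-1)$, $\mathbb{E}_k[\cdot]=\mathbb{E}[\cdot|\mathbb{F}^m_k]$. $l^2_{\mathbb{F}^m}(t;\mathbb{R}^n)$: $\mathbb{F}^m_t$-measurable square-integrable $\mathbb{R}^n$-valued variables; $l^2_{\mathbb{F}^m}(\mathbb{T}_t;\mathbb{R}^{p_0})$: processes $\{\nu_k\}_{k\in\mathbb{T}_t}$ with $\nu_k\in l^2_{\mathbb{F}^m}(k;\mathbb{R}^{p_0})$. An initial pair is $(t,z)$ with $t\in\mathbb{T}$, $z\in l^2_{\mathbb{F}^m}(t;\mathbb{R})$. The wealth under control $u$ satisfies $X_{k+1}=s_kX_k+\Theta_k^Tu_k$, $X_t=z$, $k\in\mathbb{T}_t$. Problem (MV): minimize over $u\in l^2_{\mathbb{F}^m}(\mathbb{T}_t;\mathbb{R}^{p_0})$ the functional $J_m(t,z;u)=\mathbb{E}_t[(X_N-\mathbb{E}_tX_N)^2]-\lambda\mathbb{E}_tX_N$, with $\lambda>0$. Self-coordination: define $$\widehat J_m(t,z;u,v)=\sum_{k=t}^{N-1}\mathbb{E}_t[\mu_k(u_k-v_k)^T\Phi_k(u_k-v_k)]+J_m(t,z;u),$$ $$\bar J_m(k,x;u|_{\mathbb{T}_k},v|_{\mathbb{T}_k})=\mu_k(u_k-v_k)^T\Phi_k(u_k-v_k)+J_m(k,x;v|_{\mathbb{T}_k}).$$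 $v^*\in l^2_{\mathbb{F}^m}(\mathbb{T}_t;\mathbb{R}^{p_0})$ is an open-loop self-coordination control of Problem (MV) for the initial pair $(t,z)$ and $\{\Upsilon_k,k\in\mathbb{T}_t\}$ if there is $u^*\in l^2_{\mathbb{F}^m}(\mathbb{T}_t;\mathbb{R}^{p_0})$ such that $$\widehat J_m(t,z;u^*,v^* )\le\widehat J_m(t,z;u,v^* )\quad\forall u\in l^2_{\mathbb{F}^m}(\mathbb{T}_t;\mathbb{R}^{p_0}),$$ $$\bar J_m(k,X^*_k;u^*|_{\mathbb{T}_k},v^*|_{\mathbb{T}_k})\le\bar J_m(k,X^*_k;u^*|_{\mathbb{T}_k},(v_k,v^*|_{\mathbb{T}_{k+1}}))\quad\forall k\in\mathbb{T}_t,\ \forall v_k\in l^2_{\mathbb{F}^m}(k;\mathbb{R}^{p_0}),$$ with $X^*_{k+1}=s_kX^*_k+\Theta_k^Tv^*_k$, $X^*_t=z$.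
   Formalization: Each Cov(e_k) is assumed positive definite instead of only nonnegative definite; with a degenerate covariance a self-coordination control fails to exist or to be unique (e.g. N=1, p_0=1, s_0=3/2, e_0=2 deterministic: none exists). *)

(* Defs.v *)
From HB Require Import structures.
From mathcomp Require Import all_boot all_order all_algebra.
From mathcomp Require Import all_classical all_reals all_analysis.

Set Implicit Arguments.
Unset Strict Implicit.
Unset Printing Implicit Defensive.

Import Order.TTheory GRing.Theory Num.Theory.
Local Open Scope classical_set_scope.
Local Open Scope ring_scope.

(* Time-indexed data are families over nat; only the indices in
   {0, ..., N-1} (in {0, ..., N} for the wealth) are ever relevant. *)

Section SequentlyGeneric.
Context {R : realType}.

(* The dependence of the exceptional sets on later parameters only is the
   first clause: L k a is determined by a_{k+1}, ..., a_{N-1}. *)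
Definition sequently_generic (N : nat) (Prp : (nat -> R) -> Prop) : Prop :=
  exists L : nat -> (nat -> R) -> set R,
    [/\ forall k (a b : nat -> R), (k < N)%N ->
          (forall j, (k < j < N)%N -> a j = b j) -> L k a = L k b,
        forall k a, (k < N)%N -> (@lebesgue_measure R).-negligible (L k a)
      & forall a : nat -> R,
          (forall k, (k < N)%N -> 0 < a k /\ ~ L k a (a k)) -> Prp a].

End SequentlyGeneric.

Section QuadraticForms.
Context {R : realType} {n : nat}.

Definition qform (M : 'M[R]_n) (x : 'cV[R]_n) : R := (x^T *m M *m x) 0 0.

Definition nonneg_definite (M : 'M[R]_n) : Prop := forall x, 0 <= qform M x.

Definition pos_definite (M : 'M[R]_n) : Prop :=
  forall x, x != 0 -> 0 < qform M x.

End QuadraticForms.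

Lemma qform_coupling (R : realType) (n : nat) (m : R) (M : 'M[R]_n)
    (x y : 'cV[R]_n) :
  qform (m *: block_mx M (- M) (- M) M) (col_mx x y) = m * qform M (x - y).
Proof.
rewrite /qform tr_col_mx -scalemxAr -scalemxAl mxE; congr (_ * _).
congr (fun_of_matrix _ 0 0).
rewrite mul_row_block mul_row_col !mulmxN !mulmxDl !mulNmx mulmxBr.
by rewrite [(x - y)^T]linearB !mulmxBl opprB [- _ + _]addrC.
Qed.

Section Probability.
Context {R : realType} {d : measure_display} {Omega : measurableType d}.
Variable P : probability Omega R.

Section ConditionalExpectation.
(* The conditioning sigma-algebra is given by a generating family G. *)
Variable G : set (set Omega).

Definition measurable_wrt (X : Omega -> R) : Prop :=
  measurable_fun [set: g_sigma_algebraType G] (X : g_sigma_algebraType G -> R).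

Definition is_condexp (X Y : Omega -> R) : Prop :=
  [/\ P.-integrable setT (EFin \o X),
      measurable_wrt Y,
      P.-integrable setT (EFin \o Y)
    & forall A, <<s G >> A ->
        (\int[P]_(w in A) (Y w)%:E = \int[P]_(w in A) (X w)%:E)%E].

(* An arbitrary version of E[X | G], and 0 if there is none. *)
Definition condexp (X : Omega -> R) : Omega -> R :=
  xget (cst 0) [set Y | is_condexp X Y].

Definition l2 (X : Omega -> R) : Prop :=
  measurable_wrt X /\ X \in Lfun P 2%:E.

Definition l2_vec (n : nat) (X : Omega -> 'cV[R]_n) : Prop :=
  forall i, l2 (fun w => X w i 0).

End ConditionalExpectation.

Section RandomVectors.
Context {n : nat}.

Definition cov_mx (X : Omega -> 'cV[R]_n) : 'M[R]_n :=
  \matrix_(i, j) fine (covariance P (fun w => X w i 0) (fun w => X w j 0)).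

Definition gen_vec (X : nat -> Omega -> 'cV[R]_n) (D : set nat) :
    set (set Omega) :=
  [set A | exists l i B,
     [/\ D l, measurable B & A = (fun w => X l w i 0) @^-1` B]].

(* Every A k may be taken to be the whole space, so the product rule for the
   full family includes the product rule for its subfamilies. *)
Definition independent_vecs (N : nat) (X : nat -> Omega -> 'cV[R]_n) : Prop :=
  forall A : nat -> set Omega,
    (forall k, (k < N)%N -> <<s gen_vec X [set k] >> (A k)) ->
    fine (P (\bigcap_(k < N) A k)) = \prod_(k < N) fine (P (A k)).

End RandomVectors.

Section MeanVariance.
Variables (N p0 : nat) (s : nat -> R) (e : nat -> Omega -> 'cV[R]_p0).
Variable lam : R.

Let control := nat -> Omega -> 'cV[R]_p0.

(* <<s hist k >> is the sigma-algebra generated by e_0, ..., e_{k-1}. *)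
Definition hist (k : nat) : set (set Omega) :=
  gen_vec e [set l | (l < k)%N].

Definition E_ (t : nat) (X : Omega -> R) : Omega -> R := condexp (hist t) X.

Definition Theta (k : nat) (w : Omega) : 'cV[R]_p0 := e k w - const_mx (s k).

Definition admissible (t : nat) (u : control) : Prop :=
  forall k, (t <= k < N)%N -> l2_vec (hist k) (u k).

(* The value at times k <= t is z. *)
Fixpoint wealth (t : nat) (z : Omega -> R) (u : control) (k : nat) :
    Omega -> R :=
  match k with
  | 0 => z
  | k'.+1 => if (t <= k')%N
      then fun w => s k' * wealth t z u k' w + ((Theta k' w)^T *m u k' w) 0 0
      else z
  end.

Definition J (t : nat) (z : Omega -> R) (u : control) : Omega -> R :=
  let XN := wealth t z u N in
  fun w => E_ t (fun w' => (XN w' - E_ t XN w') ^+ 2) w - lam * E_ t XN w.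

Section SelfCoordination.
Variable Ups : nat -> 'M[R]_(p0 + p0).

Definition penalty (u v : control) (k : nat) : Omega -> R :=
  fun w => qform (Ups k) (col_mx (u k w) (v k w)).

Definition Jhat (t : nat) (z : Omega -> R) (u v : control) : Omega -> R :=
  fun w => \sum_(t <= k < N) E_ t (penalty u v k) w + J t z u w.

Definition Jbar (k : nat) (x : Omega -> R) (u v : control) : Omega -> R :=
  fun w => penalty u v k w + J k x v w.

Definition replace_at (v : control) (k : nat) (vk : Omega -> 'cV[R]_p0) :
    control := fun l => if l == k then vk else v l.

Definition self_coordination (t : nat) (z : Omega -> R) (v : control) :
    Prop :=
  admissible t v /\
  exists u : control,
    [/\ admissible t u,
        forall u', admissible t u' ->
          {ae P, forall w, Jhat t z u v w <= Jhat t z u' v w}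
      & forall k vk, (t <= k < N)%N -> l2_vec (hist k) vk ->
          {ae P, forall w,
            Jbar k (wealth t z v k) u v w
            <= Jbar k (wealth t z v k) u (replace_at v k vk) w}].

End SelfCoordination.
End MeanVariance.
End Probability.

(* Main.v *)
(** With [a_k] the product of the returns after time [k], the terminal wealth is
    a multiple of [z] plus [\sum_k a_k Theta_k^T u_k], and conditional
    expectations are used only as orthogonal projections in [L^2].  Both
    optimality conditions are then equivalent to first-order conditions at each
    time [k].  Let [xi_k] be the accrued wealth under [u] minus [E_t X_N].  By
    backward induction, [E_k xi_N = rho_k xi_k + q_k] and
    [E_k (\sum_(l >= k) a_l Theta_l^T v_l) = R_k xi_k + r_k] with deterministic
    coefficients, so that the conditions at time [k] form a square linear system
    in [(u_k, v_k)] whose matrix is affine in [mu_k].  If [rho_(k+1) <> 0] this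
    matrix is invertible at [mu_k = 0], hence for all but finitely many [mu_k];
    the same holds for the matrix in which the covariance replaces the second
    moment, and its invertibility gives [rho_k <> 0].  Finally [E_t xi_N = 0]
    forces [xi_t = - q_t / rho_t], so the affine feedback determines [u] and
    [v]. *)

Require Import Defs.
From HB Require Import structures.
From mathcomp Require Import all_boot all_order all_algebra.
From mathcomp Require Import all_classical all_reals all_analysis.
From mathcomp Require Import measurable_realfun.
From mathcomp Require finmap.
From mathcomp Require Import ring lra.

Set Implicit Arguments.
Unset Strict Implicit.
Unset Printing Implicit Defensive.

Import Order.TTheory GRing.Theory Num.Theory.
Import numFieldNormedType.Exports.
Local Open Scope classical_set_scope.
Local Open Scope ring_scope.

(** * Expectations of real random variables *)

(** The variances are centred at different information. The cost of [u] is centred at the initial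
    time [t], so the condition on [u_k] contains the second moment of [Theta_k]. The cost faced by
    [v_k] is centred at time [k] itself, so only the fluctuation of [Theta_k] around its mean counts
    there: the covariance appears, and the current wealth drops out.

    The obstacle is [E_t X_N], which couples all times. It is treated as an unknown shift of the
    state, and it is found only at the end, from the consistency requirement that the deviation have
    conditional mean zero. This requirement is one scalar equation with leading coefficient [rho_t].
    Hence [rho] has to be carried through the recursion as a nonzero number, at the price of a
    second determinant to be avoided at each time.

    Costs are random variables compared almost surely. Such a comparison is tested on the events of
    the past, and the event is then absorbed into the direction of variation, since an indicator
    times an admissible direction is again admissible. The costs being exactly quadratic with
    nonnegative quadratic part, first-order conditions are also sufficient. *)

Section RealExpectation.
Context {R : realType} {d : measure_display} {Omega : measurableType d}.
Variable P : probability Omega R.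
Implicit Types (f g h : Omega -> R) (c : R).

Definition L1 f : Prop := P.-integrable setT (EFin \o f).
Definition L2 f : Prop := f \in Lfun P 2%:E.
Definition Ex f : R := \int[P]_w f w.

Lemma eq_Ex f g : f =1 g -> Ex f = Ex g.
Proof. by move=> /funext ->. Qed.

Lemma L1_measurable f : L1 f -> measurable_fun setT f.
Proof. by move=> /measurable_int/measurable_EFinP. Qed.

Lemma L1D f g : L1 f -> L1 g -> L1 (fun w => f w + g w).
Proof. by move=> hf hg; have := integrableD measurableT hf hg. Qed.

Lemma L1B f g : L1 f -> L1 g -> L1 (fun w => f w - g w).
Proof. by move=> hf hg; have := integrableB measurableT hf hg. Qed.

Lemma L1N f : L1 f -> L1 (fun w => - f w).
Proof. by move=> hf; have := integrableN hf. Qed.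

Lemma L1Z c f : L1 f -> L1 (fun w => c * f w).
Proof. by move=> hf; have := integrableZl measurableT c hf. Qed.

Lemma L1_cst c : L1 (fun=> c).
Proof. exact: finite_measure_integrable_cst. Qed.

Lemma L1_sum I (r : seq I) (Q : pred I) (F : I -> Omega -> R) :
  (forall i, L1 (F i)) -> L1 (fun w => \sum_(i <- r | Q i) F i w).
Proof.
move=> h; elim: r => [|i r ih].
  by rewrite (_ : (fun _ => _) = fun=> 0) ?funeqE => [|w]; [exact: L1_cst|rewrite big_nil].
case: (boolP (Q i)) => Qi.
  rewrite (_ : (fun _ => _) = fun w => F i w + \sum_(i <- r | Q i) F i w).
    exact: L1D.
  by apply/funext => w; rewrite big_cons Qi.
rewrite (_ : (fun _ => _) = fun w => \sum_(i <- r | Q i) F i w) //.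
by apply/funext => w; rewrite big_cons (negbTE Qi).
Qed.

Lemma L1_le f g : measurable_fun setT f -> L1 g ->
  (forall w, `|f w| <= `|g w|) -> L1 f.
Proof.
move=> mf Lg fg; apply: (le_integrable measurableT _ _ Lg).
  exact/measurable_EFinP.
by move=> w _ /=; rewrite lee_fin.
Qed.

Lemma ExD f g : L1 f -> L1 g -> Ex (fun w => f w + g w) = Ex f + Ex g.
Proof. exact: RintegralD. Qed.

Lemma ExB f g : L1 f -> L1 g -> Ex (fun w => f w - g w) = Ex f - Ex g.
Proof. exact: RintegralB. Qed.

Lemma ExZ c f : L1 f -> Ex (fun w => c * f w) = c * Ex f.
Proof. exact: RintegralZl. Qed.

Lemma Ex_cst c : Ex (fun=> c) = c.
Proof.
rewrite /Ex Rintegral_cst//.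
exact: etrans (congr1 (fun x => c * fine x) (probability_setT P)) (mulr1 c).
Qed.

Lemma ExN f : L1 f -> Ex (fun w => - f w) = - Ex f.
Proof.
move=> Lf; rewrite -mulN1r -ExZ //; apply: eq_Ex => w; by rewrite mulN1r.
Qed.

Lemma Ex_sum I (r : seq I) (Q : pred I) (F : I -> Omega -> R) :
  (forall i, L1 (F i)) ->
  Ex (fun w => \sum_(i <- r | Q i) F i w) = \sum_(i <- r | Q i) Ex (F i).
Proof.
move=> h; elim: r => [|i r ih].
  by rewrite big_nil -[RHS](Ex_cst 0); apply: eq_Ex => w; rewrite big_nil.
rewrite big_cons -ih; case: ifPn => Qi.
  rewrite -ExD //; last exact: L1_sum.
  by apply: eq_Ex => w; rewrite big_cons Qi.
by apply: eq_Ex => w; rewrite big_cons (negbTE Qi).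
Qed.

Lemma Ex_ge0 f : (forall w, 0 <= f w) -> 0 <= Ex f.
Proof. by move=> f0; apply: Rintegral_ge0. Qed.

Lemma le_Ex f g : L1 f -> L1 g -> (forall w, f w <= g w) -> Ex f <= Ex g.
Proof. by move=> ? ? fg; apply: le_Rintegral. Qed.

Lemma ExE f : L1 f -> (Ex f)%:E = (\int[P]_w (f w)%:E)%E.
Proof.
move=> Lf; rewrite /Ex /Rintegral fineK//.
exact: (@integrable_fin_num _ _ _ _ setT).
Qed.

Lemma ae_Ex f g : measurable_fun setT f -> measurable_fun setT g ->
  {ae P, forall w, f w = g w} -> Ex f = Ex g.
Proof.
move=> mf mg fg; rewrite /Ex /Rintegral; congr fine.
apply: ae_eq_integral => //; [exact/measurable_EFinP..|].
by apply: filterS fg => w -> _.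
Qed.

Lemma Ex_eq0 f : L1 f -> (forall w, 0 <= f w) -> Ex f = 0 ->
  {ae P, forall w, f w = 0}.
Proof.
move=> Lf f0 Ef0.
have Ef : (\int[P]_w (f w)%:E = 0)%E by rewrite -ExE// Ef0.
have : (\int[P]_(w in setT) `|(f w)%:E| = 0)%E.
  by rewrite -Ef; apply: eq_integral => w _; rewrite gee0_abs// lee_fin.
move=> /(ae_eq_integral_abs P measurableT (measurable_int _ Lf)) h.
by apply: filterS h => w /= /(_ I) [].
Qed.

Lemma L2_measurable f : L2 f -> measurable_fun setT f.
Proof. by rewrite /L2 inE => /andP[/[!inE]]. Qed.

Lemma L2_cst c : L2 (fun=> c).
Proof. exact: Lfun_cst. Qed.

Let le12 : (1 <= 2%:E :> \bar R)%E.
Proof. by rewrite lee_fin ler1n. Qed.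

Lemma L2D f g : L2 f -> L2 g -> L2 (fun w => f w + g w).
Proof.
by move=> fL gL; have [_ +] := Lfun_addr_closed P le12; apply.
Qed.

Lemma L2Z c f : L2 f -> L2 (fun w => c * f w).
Proof.
move=> fL; rewrite (_ : (fun _ => _) = c \o* f).
  by apply: Lfun_scale => //; rewrite ler1n.
by apply/funext => w /=; rewrite mulrC.
Qed.

Lemma L2N f : L2 f -> L2 (fun w => - f w).
Proof. by move=> fL; have := L2Z (-1) fL; under eq_fun do rewrite mulN1r. Qed.

Lemma L2B f g : L2 f -> L2 g -> L2 (fun w => f w - g w).
Proof. by move=> fL gL; apply: (L2D fL); apply: L2N. Qed.

Lemma L1M f g : L2 f -> L2 g -> L1 (fun w => f w * g w).
Proof. by move=> fL gL; apply/Lfun1_integrable; exact: Lfun2_mul_Lfun1. Qed.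

Lemma L2_L1 f : L2 f -> L1 f.
Proof.
move=> fL; apply/Lfun1_integrable; apply: Lfun_subset12 => //.
exact: fin_num_measure.
Qed.

Lemma L2P f : measurable_fun setT f -> L1 (fun w => f w ^+ 2) -> L2 f.
Proof.
move=> mf /integrableP[_ fi]; rewrite /L2 inE; apply/andP; split.
  by rewrite inE.
rewrite inE/= /finite_norm unlock; apply: poweR_lty.
apply: le_lt_trans fi; rewrite le_eqVlt; apply/orP; left; apply/eqP.
apply: eq_integral => w _ /=.
by rewrite powR_mulrn// real_normK ?num_real// ger0_norm// sqr_ge0.
Qed.

Lemma L2_bounded c f g : measurable_fun setT f -> L2 g ->
  (forall w, `|f w| <= c) -> L2 (fun w => f w * g w).
Proof.
move=> mf gL fc; apply: L2P.
  by apply: measurable_funM => //; exact: L2_measurable.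
apply: (L1_le _ (L1Z (c ^+ 2) (L1M gL gL))).
  by apply: measurable_funX; apply: measurable_funM => //; exact: L2_measurable.
move=> w /=; rewrite -expr2 -exprMn !normrX ler_pXn2r ?nnegrE// !normrM.
by apply: ler_wpM2r => //; rewrite (le_trans (fc w))// ler_norm.
Qed.

End RealExpectation.

(** * Conditional expectation as a projection *)

Section SubSigmaAlgebra.
Import HBNNSimple finmap.
Context {R : realType} {d : measure_display} {Omega : measurableType d}.
Variable P : probability Omega R.
Variable G : set (set Omega).
Hypothesis sG : forall A, <<s G >> A -> measurable A.
Implicit Types (X Y Z : Omega -> R).

Lemma measurable_wrtW X : measurable_wrt G X -> measurable_fun setT X.
Proof. by move=> mX _ B mB; apply: sG; exact: mX. Qed.

Lemma id_measurable :
  measurable_fun setT (id : Omega -> g_sigma_algebraType G).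
Proof. by move=> _ B mB; rewrite setTI; exact: sG. Qed.

(** For a simple [Y] this is the hypothesis summed over its level sets, which belong to the
    sub-sigma-algebra; monotone convergence gives the rest. The integrals may be infinite, which is
    what lets [indep_L1] deduce integrability from this identity. *)
Lemma integral_pull_ge0 X Z :
  measurable_fun setT X -> measurable_fun setT Z ->
  (forall w, 0 <= X w) -> (forall w, 0 <= Z w) ->
  (forall A, <<s G >> A ->
    \int[P]_(w in A) (X w)%:E = \int[P]_(w in A) (Z w)%:E)%E ->
  forall Y, measurable_wrt G Y -> (forall w, 0 <= Y w) ->
  (\int[P]_w (Y w * X w)%:E = \int[P]_w (Y w * Z w)%:E)%E.
Proof.
move=> mX mZ X0 Z0 XZ Y mY Y0.
have mYE : measurable_fun [set: g_sigma_algebraType G]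
  (EFin \o Y : g_sigma_algebraType G -> \bar R) by exact/measurable_EFinP.
pose f_ := nnsfun_approx measurableT mYE.
have mf n : measurable_fun setT (f_ n : Omega -> R).
  exact/measurable_wrtW/measurable_funP.
have lim (W : Omega -> R) : measurable_fun setT W -> (forall w, 0 <= W w) ->
  (\int[P]_w (Y w * W w)%:E = limn (fun n => \int[P]_w (f_ n w * W w)%:E))%E.
  move=> mW W0; rewrite -monotone_convergence//; last 3 first.
  - by move=> n; apply/measurable_EFinP; apply: measurable_funM.
  - by move=> n w _; rewrite lee_fin mulr_ge0.
  - move=> w _ m n mn; rewrite lee_fin ler_wpM2r//.
    by have /lefP/(_ w) := nd_nnsfun_approx measurableT mYE mn.
  apply: eq_integral => w _; apply/esym/cvg_lim => //.
  under eq_fun do rewrite EFinM.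
  rewrite EFinM; apply: cvgeMr => //.
  apply: cvg_nnsfun_approx => //.
  by move=> x _; rewrite lee_fin.
have simple (W : Omega -> R) n : measurable_fun setT W -> (forall w, 0 <= W w) ->
  (\int[P]_w (f_ n w * W w)%:E =
    \sum_(r \in range (f_ n)) r%:E * \int[P]_(w in f_ n @^-1` [set r]) (W w)%:E)%E.
  move=> mW W0.
  have mA r : measurable (f_ n @^-1` [set r] : set Omega).
    by rewrite -[X in measurable X]setTI; apply: mf.
  have fin : finite_set (range (f_ n)) by [].
  transitivity (\int[P]_w (\sum_(r <- fset_set (range (f_ n)))
     (r * (\1_(f_ n @^-1` [set r]) w * W w))%:E))%E.
    apply: eq_integral => w _; rewrite sumEFin; congr EFin.
    rewrite [in LHS](fimfunE (f_ n)) /= fsbig_finite//= mulr_suml.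
    by apply: eq_bigr => r _; rewrite mulrA.
  rewrite ge0_integral_sum//; last 2 first.
  - move=> r; apply/measurable_EFinP; apply: measurable_funM => //.
    exact: measurable_funM.
  - by move=> r w _; rewrite lee_fin mulrA mulr_ge0// -lee_fin EFinM nnfun_muleindic_ge0.
  rewrite fsbig_finite//=; apply: eq_big_seq => r; rewrite in_fset_set// => /set_mem[w _ <-].
  under eq_integral do rewrite EFinM.
  rewrite ge0_integralZl_EFin//; last 2 first.
  - by move=> v _; rewrite lee_fin mulr_ge0.
  - by apply/measurable_EFinP; apply: measurable_funM.
  congr (_ * _)%E; rewrite [RHS]integral_mkcond; apply: eq_integral => v _.
  by rewrite patchE indicE; case: ifPn; rewrite ?mul1r ?mul0r.
rewrite (lim X)// (lim Z)//; congr (limn _); apply/funext => n.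
rewrite (simple X n)// (simple Z n)//.
apply: eq_fsbigr => r _; rewrite XZ//.
by have := @measurable_funP _ _ _ _ _ (f_ n) measurableT _ (measurable_set1 r); rewrite setTI.
Qed.

End SubSigmaAlgebra.

Section CondExp.
Context {R : realType} {d : measure_display} {Omega : measurableType d}.
Variable P : probability Omega R.
Variable G : set (set Omega).
Hypothesis sG : forall A, <<s G >> A -> measurable A.
Implicit Types (X Y Z : Omega -> R).

Let sub_id : Omega -> g_sigma_algebraType G := id.
Let sub_id_mfun := isMeasurableFun.Build _ _ _ _ sub_id (id_measurable sG).
Let sub_id_pack : {mfun Omega >-> g_sigma_algebraType G} :=
  HB.pack sub_id sub_id_mfun.

Lemma L1_integral_Ex X A : measurable A ->
  L1 P X -> (\int[P]_(w in A) (X w)%:E)%E = (Ex P (fun w => \1_A w * X w))%:E.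
Proof.
move=> mA LX; rewrite ExE.
  rewrite integral_mkcond; apply: eq_integral => w _.
  by rewrite patchE indicE; case: ifPn; rewrite ?mul1r ?mul0r.
apply: (L1_le _ LX).
  by apply: measurable_funM; [exact: measurable_indic|exact: L1_measurable LX].
move=> w; rewrite indicE; case: (_ \in _); rewrite ?mul1r// mul0r normr0//.
Qed.

Lemma L1_pull_norm X Y : measurable_fun setT X -> measurable_fun setT Y ->
  L1 P (fun w => Y w * X w) -> L1 P (fun w => `|Y w| * `|X w|).
Proof.
move=> mX mY h; apply: (L1_le _ h).
  by apply: measurable_funM; apply: measurableT_comp.
by move=> w; rewrite -normrM normr_id.
Qed.

(* Adding [|X| + |Z|] to [X] and [Z], and [|Y|] to [Y], reduces the claim to
   nonnegative functions. *)
Lemma Ex_pull X Z Y : L1 P X -> L1 P Z ->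
  (forall A, <<s G >> A ->
    \int[P]_(w in A) (X w)%:E = \int[P]_(w in A) (Z w)%:E)%E ->
  measurable_wrt G Y ->
  L1 P (fun w => Y w * X w) -> L1 P (fun w => Y w * Z w) ->
  Ex P (fun w => Y w * X w) = Ex P (fun w => Y w * Z w).
Proof.
move=> LX LZ XZ mY LYX LYZ.
have mX := L1_measurable LX; have mZ := L1_measurable LZ.
have mY' := measurable_wrtW sG mY.
have LnX : L1 P (fun w => `|X w|).
  by apply: (L1_le _ LX) => [|w]; rewrite ?normr_id//; exact: measurableT_comp.
have LnZ : L1 P (fun w => `|Z w|).
  by apply: (L1_le _ LZ) => [|w]; rewrite ?normr_id//; exact: measurableT_comp.
pose W (w : Omega) : R := `|X w| + `|Z w|.
have LW : L1 P W by exact: L1D.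
have mW := L1_measurable LW.
have nYX := L1_pull_norm mX mY' LYX; have nYZ := L1_pull_norm mZ mY' LYZ.
have nonneg (V : Omega -> R) : measurable_wrt G V -> (forall w, 0 <= V w) ->
    (forall w, V w <= 2 * `|Y w|) ->
    Ex P (fun w => V w * X w) = Ex P (fun w => V w * Z w).
  move=> mV V0 VY; have mV' := measurable_wrtW sG mV.
  have LV (F : Omega -> R) : measurable_fun setT F -> L1 P (fun w => `|Y w| * `|F w|) ->
      L1 P (fun w => V w * F w).
    move=> mF /(L1Z 2) h; apply: (L1_le _ h); first exact: measurable_funM.
    move=> w; rewrite !normrM !normr_id mulrA ler_wpM2r//.
    by rewrite (ger0_norm (V0 w)) normr_nat.
  have LVX := LV _ mX nYX; have LVZ := LV _ mZ nYZ.
  have LVW : L1 P (fun w => V w * W w).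
    rewrite (_ : (fun _ => _) = fun w => V w * `|X w| + V w * `|Z w|); last first.
      by apply/funext => w; rewrite mulrDr.
    apply: L1D.
      apply: (L1_le _ LVX) => [|w]; last by rewrite !normrM normr_id.
      by apply: measurable_funM => //; exact: L1_measurable LnX.
    apply: (L1_le _ LVZ) => [|w]; last by rewrite !normrM normr_id.
    by apply: measurable_funM => //; exact: L1_measurable LnZ.
  have : Ex P (fun w => V w * (X w + W w)) = Ex P (fun w => V w * (Z w + W w)).
    congr fine; apply: (integral_pull_ge0 sG _ _ _ _ _ mV V0).
    - exact: measurable_funD.
    - exact: measurable_funD.
    - move=> w; rewrite /W addrA addr_ge0// -lerBlDl sub0r.
      by rewrite -normrN ler_norm.
    - move=> w; rewrite /W [`|X w| + _]addrC addrA addr_ge0// -lerBlDl sub0r.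
      by rewrite -normrN ler_norm.
    - move=> A sA; have mA := sG sA.
      under eq_integral do rewrite EFinD.
      under [RHS]eq_integral do rewrite EFinD.
      by rewrite !integralD//= ?XZ//; exact: integrableS measurableT mA (@subsetT _ _) _.
  under eq_Ex do rewrite mulrDr.
  under [X in _ = X -> _]eq_Ex do rewrite mulrDr.
  by rewrite !ExD// => /addIr.
have := nonneg (fun w => `|Y w| + Y w); have := nonneg (fun w => `|Y w|).
have mnY : measurable_wrt G (fun w => `|Y w|) by exact: measurableT_comp.
move=> /(_ mnY) h1 /(_ (measurable_funD mnY mY)) h2.
have {}h1 : Ex P (fun w => `|Y w| * X w) = Ex P (fun w => `|Y w| * Z w).
  by apply: h1 => // w; rewrite ler_peMl// ler1n.
have {h2} : Ex P (fun w => (`|Y w| + Y w) * X w) = Ex P (fun w => (`|Y w| + Y w) * Z w).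
  apply: h2 => // w.
    by rewrite -lerBlDr sub0r -normrN ler_norm.
  by rewrite mulr_natl mulr2n lerD2l ler_norm.
have LnYX : L1 P (fun w => `|Y w| * X w).
  apply: (L1_le _ LYX) => [|w]; last by rewrite !normrM normr_id.
  by apply: measurable_funM => //; exact: measurable_wrtW mnY.
have LnYZ : L1 P (fun w => `|Y w| * Z w).
  apply: (L1_le _ LYZ) => [|w]; last by rewrite !normrM normr_id.
  by apply: measurable_funM => //; exact: measurable_wrtW mnY.
under eq_Ex do rewrite mulrDl.
under [X in _ = X -> _]eq_Ex do rewrite mulrDl.
by rewrite !ExD// h1 => /addrI.
Qed.

(** The Radon-Nikodym derivative on the sub-sigma-algebra: the charge with density [X] and the
    measure [P] are both pushed forward along the identity map, and the first is dominated by the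
    second. The derivative is finite everywhere, so [fine] loses nothing. *)
Lemma condexp_exists X : L1 P X -> exists Z, is_condexp P G X Z.
Proof.
move=> LX.
pose nu := pushforward (induced_charge LX) sub_id_pack.
pose Q := distribution P sub_id_pack.
have mid : measurable_fun setT (sub_id_pack : Omega -> g_sigma_algebraType G).
  exact: id_measurable.
have [cnu cnuE] : exists cnu : {charge set (g_sigma_algebraType G) -> \bar R},
    forall A, cnu A = (\int[P]_(w in A) (X w)%:E)%E.
  by unshelve eexists (nu : {charge set (g_sigma_algebraType G) -> \bar R}).
have domQ : cnu `<< Q.
  apply/null_content_dominatesP => A sA QA0; rewrite cnuE.
  apply: null_set_integral => //; first exact: sG.
  exact/measurable_EFinP/measurable_funTS/(L1_measurable LX).
have finf x := Radon_Nikodym_fin_num x domQ.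
have intf := Radon_Nikodym_integrable domQ.
have Ef A sA := @Radon_Nikodym_integral _ _ _ cnu Q A domQ sA.
set f := Radon_Nikodym _ _ in finf intf Ef.
exists (fine \o f); have fE : EFin \o (fine \o f) = f.
  by apply/funext => w /=; rewrite fineK.
have mf : measurable_wrt G (fine \o f).
  by apply/measurable_EFinP; rewrite fE; exact: measurable_int intf.
have fi : P.-integrable setT (EFin \o (fine \o f) : Omega -> \bar R).
  have /integrableP[mf' fi] := intf.
  apply/integrableP; split.
    exact/measurable_EFinP/(measurable_wrtW sG mf).
  apply: le_lt_trans fi; rewrite ge0_integral_pushforward//=.
    rewrite le_eqVlt; apply/orP; left; apply/eqP/eq_integral => w _ /=.
    by rewrite -[in RHS](fineK (finf w)).
  exact: measurableT_comp.
split => // A sA.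
rewrite -cnuE (Ef A sA) integral_pushforward//.
- by apply: eq_integral => w _ /=; rewrite fineK.
- exact: measurable_int intf.
- apply: (integrableS measurableT (sG sA) (@subsetT _ _)).
  apply: eq_integrable fi => // w _ /=; exact: fineK.
Qed.

End CondExp.

Section Projection.
Context {R : realType} {d : measure_display} {Omega : measurableType d}.
Variable P : probability Omega R.
Implicit Types (X Y Z : Omega -> R).

(** Monotone convergence along the sets where [g] is at most [n]. It serves to show that a
    conditional expectation, a priori only integrable, is square integrable. *)
Lemma L1_of_truncations (g F : Omega -> R) (c : R) :
  measurable_fun setT g -> measurable_fun setT F -> (forall w, 0 <= F w) ->
  (forall n : nat, L1 P (fun w => \1_[set w | g w <= n%:R] w * F w) /\
    Ex P (fun w => \1_[set w | g w <= n%:R] w * F w) <= c) ->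
  L1 P F.
Proof.
move=> mg mF F0 tr.
pose u n w : R := \1_[set w | g w <= n%:R] w * F w.
have u0 n w : 0 <= u n w by rewrite mulr_ge0// indicE.
have cv w : limn (fun n => (u n w)%:E) = (F w)%:E.
  apply/cvg_lim => //; apply: cvg_near_cst.
  near=> n; rewrite /u indicE mem_set ?mul1r//=.
  by near: n; exact: nbhs_infty_ger.
have uc : (fun n => \int[P]_w (u n w)%:E)%E @ \oo --> (\int[P]_w (F w)%:E)%E.
  rewrite (_ : (\int[P]_w (F w)%:E)%E = (\int[P]_w limn (fun n => (u n w)%:E))%E).
    apply: cvg_monotone_convergence => //.
    - by move=> n; have /measurable_int := (tr n).1.
    - by move=> n w _; rewrite lee_fin.
    - move=> w _ m n mn; rewrite lee_fin /u ler_wpM2r// !indicE.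
      rewrite ler_nat; case: (boolP (w \in [set w | g w <= m%:R])) => // /set_mem /= h.
      by rewrite mem_set//= (le_trans h)// ler_nat.
  by apply: eq_integral => w _; rewrite cv.
have le_c : (\int[P]_w (F w)%:E <= c%:E)%E.
  apply: cvge_le uc; apply: nearW => n.
  by have [h1 h2] := tr n; rewrite -ExE// lee_fin.
apply/integrableP; split; first exact/measurable_EFinP.
apply: le_lt_trans (le_lt_trans le_c (ltry c)).
rewrite le_eqVlt; apply/orP; left; apply/eqP; apply: eq_integral => w _ /=.
by rewrite ger0_norm.
Unshelve. all: by end_near. Qed.

Variable G : set (set Omega).
Hypothesis sG : forall A, <<s G >> A -> measurable A.

Lemma l2_L2 X : l2 P G X -> L2 P X. Proof. by case. Qed.

Lemma indic_wrt A : <<s G >> A -> measurable_wrt G (\1_A : Omega -> R).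
Proof. by move=> sA; exact: (@measurable_indic _ (g_sigma_algebraType G)). Qed.

Lemma l2_cst (c : R) : l2 P G (fun=> c).
Proof. by split; [exact: measurable_cst|exact: L2_cst]. Qed.

Lemma l2D X Y : l2 P G X -> l2 P G Y -> l2 P G (fun w => X w + Y w).
Proof. by move=> [mX hX] [mY hY]; split; [exact: measurable_funD|exact: L2D]. Qed.

Lemma l2Z c X : l2 P G X -> l2 P G (fun w => c * X w).
Proof. by move=> [mX hX]; split; [exact: measurable_funM|exact: L2Z]. Qed.

Lemma l2N X : l2 P G X -> l2 P G (fun w => - X w).
Proof. by move=> /(l2Z (-1)); under eq_fun do rewrite mulN1r. Qed.

Lemma l2B X Y : l2 P G X -> l2 P G Y -> l2 P G (fun w => X w - Y w).
Proof. by move=> hX hY; apply: l2D => //; exact: l2N. Qed.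

Lemma l2_sum I (r : seq I) (Q : pred I) (F : I -> Omega -> R) :
  (forall i, Q i -> l2 P G (F i)) -> l2 P G (fun w => \sum_(i <- r | Q i) F i w).
Proof.
move=> h; elim: r => [|i r ih].
  by under eq_fun do rewrite big_nil; exact: l2_cst.
under eq_fun do rewrite big_cons.
by case: (boolP (Q i)) => // Qi; apply: l2D => //; exact: h.
Qed.

Lemma l2_indicM A X : <<s G >> A -> l2 P G X -> l2 P G (fun w => \1_A w * X w).
Proof.
move=> sA [mX hX]; split; first by apply: measurable_funM => //; exact: indic_wrt.
apply: (@L2_bounded _ _ _ _ 1) => //; first exact/measurable_indic/sG.
by move=> w; rewrite indicE; case: (_ \in _); rewrite ?normr0// normr1.
Qed.

Lemma l2_eq0 Z : l2 P G Z -> (forall Y, l2 P G Y -> Ex P (fun w => Z w * Y w) = 0) ->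
  {ae P, forall w, Z w = 0}.
Proof.
move=> hZ /(_ _ hZ) h.
have := Ex_eq0 (L1M hZ.2 hZ.2) (fun w => sqr_ge0 (Z w)) h.
by apply: filterS => w /eqP; rewrite mulf_eq0 orbb => /eqP.
Qed.

Lemma condexpP X : L1 P X -> is_condexp P G X (condexp P G X).
Proof. by move=> /(condexp_exists sG) [Z hZ]; apply: (@xgetPex _ (cst 0)); exists Z. Qed.

Lemma condexp_Ex X Z A : is_condexp P G X Z -> <<s G >> A ->
  Ex P (fun w => \1_A w * Z w) = Ex P (fun w => \1_A w * X w).
Proof.
move=> [LX _ LZ h] sA; apply: EFin_inj.
by rewrite -!L1_integral_Ex ?h//; exact: sG.
Qed.

(* For [Y] the truncation of [Z] at [n], [E Y^2 = E (X Y)] and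
   [2 X Y <= X^2 + Y^2] bound [E Y^2] by [E X^2] uniformly in [n]. *)
Lemma condexp_l2 X Z : L2 P X -> is_condexp P G X Z -> l2 P G Z.
Proof.
move=> LX [iX mZ iZ XZ]; split => //.
have mZ' := measurable_wrtW sG mZ.
apply: L2P => //; apply: (@L1_of_truncations (fun w => `|Z w|) _ (Ex P (fun w => X w ^+ 2))).
- exact: measurableT_comp.
- exact: measurable_funX.
- by move=> w; exact: sqr_ge0.
move=> n; set A := [set w | `|Z w| <= n%:R].
have sA : <<s G >> A.
  have : measurable_fun [set: g_sigma_algebraType G] (fun w => `|Z w|) by exact: measurableT_comp.
  move=> /(_ measurableT _ (measurable_itv `]-oo, n%:R])); rewrite setTI.
  by congr (<<s G >> _); apply/seteqP; split => w /=; rewrite in_itv.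
pose Y w : R := \1_A w * Z w.
have mY : measurable_wrt G Y by apply: measurable_funM => //; exact: indic_wrt.
have mY' := measurable_wrtW sG mY.
have Yn w : `|Y w| <= n%:R.
  rewrite /Y indicE; case: (boolP (w \in A)) => [/set_mem|_]; first by rewrite mul1r.
  by rewrite mul0r normr0.
have LY F : L1 P F -> L1 P (fun w => Y w * F w).
  move=> LF; apply: (L1_le _ (L1Z n%:R LF)) => [|w].
    by apply: measurable_funM => //; exact: L1_measurable LF.
  by rewrite [leLHS]normrM [leRHS]normrM normr_nat ler_wpM2r.
have E := Ex_pull sG iZ iX XZ mY (LY _ iZ) (LY _ iX).
have YZ w : \1_A w * Z w ^+ 2 = Y w * Z w by rewrite /Y expr2 mulrA.
have YY w : Y w * Z w = Y w ^+ 2.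
  by rewrite /Y indicE; case: (_ \in _); rewrite ?mul1r ?mul0r ?expr2 ?mul0r.
have LX2 : L1 P (fun w => X w ^+ 2) by exact: L1M.
under eq_fun do rewrite YZ.
split; first exact: LY.
have : Ex P (fun w => Y w * X w) <= Ex P (fun w => 2^-1 * X w ^+ 2 + 2^-1 * (Y w * Z w)).
  apply: le_Ex => [|| w]; first exact: LY.
    by apply: L1D; apply: L1Z => //; exact: LY.
  by rewrite YY; have := sqr_ge0 (X w - Y w); nra.
rewrite -E ExD ?ExZ //; [lra|exact: LY|exact: L1Z|apply: L1Z; exact: LY].
Qed.

(** Orthogonal projection onto the square-integrable [G]-measurable variables, characterized by test
    functions. Unlike [condexp], which is an arbitrarily chosen version, it can be verified for an
    explicit candidate; [is_proj_ae] then compares the two. *)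
Definition is_proj X Z : Prop := l2 P G Z /\
  forall Y, l2 P G Y -> Ex P (fun w => X w * Y w) = Ex P (fun w => Z w * Y w).

Lemma condexp_proj X : L2 P X -> is_proj X (condexp P G X).
Proof.
move=> LX; have h := condexpP (L2_L1 LX); have hZ := condexp_l2 LX h.
split => // Y [mY LY]; case: h => [iX mZ iZ XZ].
under eq_Ex do rewrite mulrC.
under [RHS]eq_Ex do rewrite mulrC.
by apply/esym/(Ex_pull sG iZ iX XZ mY); apply: L1M => //; case: hZ.
Qed.

Lemma is_proj_ae X Z Z' : L2 P X -> is_proj X Z -> is_proj X Z' ->
  {ae P, forall w, Z w = Z' w}.
Proof.
move=> LX [hZ pZ] [hZ' pZ'].
have : {ae P, forall w, Z w - Z' w = 0}.
  apply: l2_eq0 => [|Y hY]; first exact: l2B.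
  under eq_Ex do rewrite mulrBl.
  by rewrite ExB -?pZ -?pZ' ?subrr//; apply: L1M; apply: l2_L2.
by apply: filterS => w /eqP; rewrite subr_eq0 => /eqP.
Qed.

(** The event where [D] is negative belongs to the sub-sigma-algebra; there the integral of [D] is
    both nonnegative and nonpositive. This converts inequalities between expectations on events into
    almost sure inequalities between conditional costs. *)
Lemma wrt_ge0_ae D : measurable_wrt G D -> L1 P D ->
  (forall A, <<s G >> A -> 0 <= Ex P (fun w => \1_A w * D w)) ->
  {ae P, forall w, 0 <= D w}.
Proof.
move=> mD LD h; pose A := [set w | D w < 0].
have sA : <<s G >> A.
  have := mD measurableT _ (measurable_itv `]-oo, 0%R[); rewrite setTI.
  by congr (<<s G >> _); apply/seteqP; split => w /=; rewrite in_itv.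
have mA := sG sA.
have L : L1 P (fun w => \1_A w * D w).
  apply: (L1_le _ LD) => [|w].
    by apply: measurable_funM; [exact: measurable_indic|exact: L1_measurable LD].
  by rewrite indicE; case: (_ \in _); rewrite ?mul1r// mul0r normr0.
have pos w : 0 <= - (\1_A w * D w).
  rewrite indicE; case: (boolP (w \in A)) => [/set_mem /= Dw|_].
    by rewrite mul1r oppr_ge0 ltW.
  by rewrite mul0r oppr0.
have E0 : Ex P (fun w => - (\1_A w * D w)) = 0.
  apply/eqP; rewrite eq_le Ex_ge0// andbT ExN// oppr_le0; exact: h.
have := Ex_eq0 (L1N L) pos E0.
apply: filterS => w; rewrite indicE; case: (boolP (w \in A)).
  by move=> /set_mem /= Dw /eqP; rewrite mul1r oppr_eq0 => /eqP ->.
by rewrite notin_setE /= => /negP; rewrite -leNgt.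
Qed.

End Projection.

(** * Independence of the returns *)

Section Independence.
Context {R : realType} {d : measure_display} {Omega : measurableType d}.
Variable P : probability Omega R.
Variables (N p0 : nat) (e : nat -> Omega -> 'cV[R]_p0).
Hypothesis e_meas : forall k i, (k < N)%N -> measurable_fun setT (fun w => e k w i 0).
Hypothesis e_indep : independent_vecs P N e.

Lemma gen_vec_measurable D A : (forall l, D l -> (l < N)%N) ->
  <<s gen_vec e D >> A -> measurable A.
Proof.
move=> DN; apply: smallest_sub; first exact: sigma_algebra_measurable.
move=> _ [l [i [B [Dl mB ->]]]]; rewrite -[X in measurable X]setTI.
by apply: e_meas => //; exact: DN.
Qed.

Lemma gen_vecS D D' : D `<=` D' -> <<s gen_vec e D >> `<=` <<s gen_vec e D' >>.
Proof.
move=> DD'; apply: sub_sigma_algebra2.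
by move=> _ [l [i [B [Dl mB ->]]]]; exists l, i, B; split => //; exact: DD'.
Qed.

Lemma hist_measurable k A : (k <= N)%N -> <<s hist e k >> A -> measurable A.
Proof. by move=> kN; apply: gen_vec_measurable => l /= /leq_trans; apply. Qed.

Lemma measurable_wrtS (G G' : set (set Omega)) (X : Omega -> R) :
  <<s G >> `<=` <<s G' >> -> measurable_wrt G X -> measurable_wrt G' X.
Proof. by move=> GG' mX _ B mB; apply: GG'; exact: mX. Qed.

Lemma l2_histS j k X : (j <= k)%N -> l2 P (hist e j) X -> l2 P (hist e k) X.
Proof.
move=> jk [mX LX]; split => //; apply: measurable_wrtS mX.
by apply: gen_vecS => l /= /leq_trans; apply.
Qed.

Lemma gen_vec_wrt (D : set nat) l i : D l ->
  measurable_wrt (gen_vec e D) (fun w => e l w i 0).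
Proof.
move=> Dl _ B mB; rewrite setTI; apply: sub_sigma_algebra.
by exists l, i, B.
Qed.

(** With [A] fixed, the finite measures sending [B] to [P (A & B)] and to [P A * P B] agree on a
    pi-system that generates at least the past of [k]. *)
Lemma indep_hist k A B : (k < N)%N ->
  <<s gen_vec e [set k] >> A -> <<s hist e k >> B ->
  P (A `&` B) = (P A * P B)%E.
Proof.
move=> kN sA.
have gm l C : (l < N)%N -> <<s gen_vec e [set l] >> C -> measurable C.
  by move=> lN; apply: gen_vec_measurable => _ ->.
have mA := gm _ _ kN sA.
(* The pi-system: intersections of one event for each return before time [k]. Taking all factors but
   one to be the whole space shows that it contains the generators of [hist e k]. *)
pose C : set (set Omega) := [set B | exists F : nat -> set Omega,
  (forall j, (j < k)%N -> <<s gen_vec e [set j] >> (F j)) /\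
  B = \bigcap_(j < k) F j].
have CT : C setT.
  exists (fun=> setT); split; first by move=> j _; exact: (@measurableT _ (g_sigma_algebraType _)).
  by rewrite bigcapT.
have Cm : C `<=` measurable.
  move=> _ [F [sF ->]]; apply: bigcap_measurableType.
  by move=> j /= jk; apply: (gm j); [exact: ltn_trans kN|exact: sF].
have prodC D B' : <<s gen_vec e [set k] >> D -> C B' ->
    P (D `&` B') = (P D * P B')%E.
  have fin (S : set Omega) : measurable S -> P S \is a fin_num by exact: fin_num_measure.
  have prod_rule S F : <<s gen_vec e [set k] >> S ->
      (forall j, (j < k)%N -> <<s gen_vec e [set j] >> (F j)) ->
      fine (P (S `&` \bigcap_(j < k) F j)) =
      fine (P S) * \prod_(0 <= j < k) fine (P (F j)).
    move=> sS sF.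
    (* The product rule is stated for full families, so the whole space is inserted after time [k],
       where it contributes the factor 1. *)
    pose A' j := if (j < k)%N then F j else if j == k then S else setT.
    have -> : S `&` \bigcap_(j < k) F j = \bigcap_(j < N) A' j.
      apply/seteqP; split => [w [Dw Fw] j jN|w Aw].
        by rewrite /A'; case: ifPn => [/Fw//|_]; case: eqP.
      split; first by have := Aw _ kN; rewrite /A' ltnn eqxx.
      by move=> j jk; have := Aw _ (ltn_trans jk kN); rewrite /A' jk.
    rewrite e_indep; last first.
      move=> j jN; rewrite /A'; case: ifPn => [/sF//|_]; case: eqP => [->//|_].
      exact: (@measurableT _ (g_sigma_algebraType _)).
    rewrite -(big_mkord xpredT (fun j => fine (P (A' j)))).
    rewrite (big_cat_nat (n := k))//=; last exact: ltnW.
    rewrite [X in _ * X]big_ltn// mulrCA [X in _ * (_ * X)]big1_seq ?mulr1.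
      by congr (_ * _); [rewrite /A' ltnn eqxx|apply: eq_big_nat => j /andP[_ jk]; rewrite /A' jk].
    move=> j /=; rewrite mem_index_iota => /andP[kj _].
    by rewrite /A' ltnNge (ltnW kj)/= gtn_eqF// (probability_setT P : P setT = 1%E).
  move=> sD CB; have mB := Cm _ CB; have [F [sF BF]] := CB.
  rewrite -(fineK (fin _ (gm _ _ kN sD))) -(fineK (fin _ mB)).
  rewrite -(fineK (fin _ (measurableI _ _ (gm _ _ kN sD) mB))) -EFinM; congr EFin.
  rewrite BF prod_rule//; congr (_ * _).
  (* The same rule with the whole space at time [k] evaluates [P B'] itself as the product. *)
  have := prod_rule setT F _ sF; rewrite setTI probability_setT mul1r => -> //.
  exact: (@measurableT _ (g_sigma_algebraType _)).
have histC : hist e k `<=` C.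
  move=> _ [l [i [B' [/= lk mB' ->]]]].
  exists (fun j => if j == l then (fun w => e l w i 0) @^-1` B' else setT).
  split.
    move=> j jk; case: eqP => [->|_].
      by apply: sub_sigma_algebra; exists l, i, B'.
    exact: (@measurableT _ (g_sigma_algebraType _)).
  apply/seteqP; split => w /=.
    by move=> h j jk /=; case: eqP.
  by move=> /(_ _ lk); rewrite eqxx.
have fA : (0 <= fine (P A)) by rewrite fine_ge0.
move=> sB.
have CI : setI_closed C.
  move=> _ _ [F [sF ->]] [F' [sF' ->]]; exists (fun j => F j `&` F' j); split.
    by move=> j jk; apply: (@measurableI _ (g_sigma_algebraType _)); [exact: sF|exact: sF'].
  by rewrite bigcapI.
have cover : \bigcup_(k : nat) [set: Omega] = setT.
  by apply/seteqP; split => // w _; exists 0%N.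
have : mrestr P mA B = mscale (NngNum fA) P B.
  apply: (@g_sigma_algebra_measure_unique _ _ _ C Cm (fun=> setT) (fun=> CT) cover
    (mrestr P mA) (mscale (NngNum fA) P) CI _ _ B (sub_sigma_algebra2 histC sB)).
    move=> B' CB'; change (P (B' `&` A) = (fine (P A))%:E * P B')%E.
    rewrite setIC prodC// fineK//.
    exact: fin_num_measure.
  move=> _; change (P (setT `&` A) < +oo)%E; rewrite setTI.
  exact: le_lt_trans (probability_le1 P mA) (ltry _).
rewrite /mrestr /mscale /= setIC => ->.
by rewrite fineK// fin_num_measure.
Qed.

(** The roles are exchanged: by [indep_hist] the indicator of [B] has the constant [P B] as
    conditional expectation given [e_k], and [X] is the measurable factor that [Ex_pull] moves
    across. *)
Lemma indep_Ex1 k X B : (k < N)%N -> measurable_wrt (gen_vec e [set k]) X ->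
  L1 P X -> <<s hist e k >> B ->
  (\int[P]_(w in B) (X w)%:E = \int[P]_(w in B) (Ex P X)%:E)%E.
Proof.
move=> kN mX LX sB.
have mB : measurable B by apply: (hist_measurable (ltnW kN)).
have sG A : <<s gen_vec e [set k] >> A -> measurable A.
  by apply: gen_vec_measurable => _ ->.
rewrite !L1_integral_Ex//; last exact: L1_cst.
have LI : L1 P (\1_B : Omega -> R).
  apply: (L1_le _ (L1_cst P 1)) => [|w]; first exact: measurable_indic.
  by rewrite indicE; case: (_ \in _); rewrite ?normr0 ?normr1.
congr EFin.
under [RHS]eq_Ex do rewrite mulrC.
rewrite ExZ// mulrC.
have EB : Ex P (\1_B : Omega -> R) = fine (P B).
  by rewrite /Ex /Rintegral; congr fine; rewrite integral_indic// setIT.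
under eq_Ex do rewrite mulrC.
rewrite (Ex_pull sG (X := \1_B) (Z := fun=> fine (P B)) LI (L1_cst P _) _ mX).
- by under eq_Ex do rewrite mulrC; rewrite ExZ// EB.
- move=> A sA; have mA := sG _ sA.
  rewrite integral_cst// integral_indic// fineK ?fin_num_measure// muleC setIC.
  exact: indep_hist kN sA sB.
- apply: (L1_le _ LX) => [|w].
    by apply: measurable_funM; [exact: L1_measurable LX|exact: measurable_indic].
  by rewrite indicE; case: (_ \in _); rewrite ?mulr1// mulr0 normr0.
- by under eq_fun do rewrite mulrC; exact: L1Z.
Qed.

(** Integrability of the product comes from independence, not from Hölder's inequality. It is needed
    for squares of [Theta_k] and of past variables, which are only integrable. *)
Lemma indep_L1 k X Y : (k < N)%N -> measurable_wrt (gen_vec e [set k]) X ->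
  L1 P X -> measurable_wrt (hist e k) Y -> L1 P Y -> L1 P (fun w => Y w * X w).
Proof.
move=> kN mX LX mY LY.
have sG A : <<s hist e k >> A -> measurable A by apply: hist_measurable; exact: ltnW.
have mX' := L1_measurable LX; have mY' := L1_measurable LY.
have LnX : L1 P (fun w => `|X w|).
  by apply: (L1_le _ LX) => [|w]; rewrite ?normr_id//; exact: measurableT_comp.
have LnY : L1 P (fun w => `|Y w|).
  by apply: (L1_le _ LY) => [|w]; rewrite ?normr_id//; exact: measurableT_comp.
apply/integrableP; split; first by apply/measurable_EFinP; exact: measurable_funM.
under eq_integral do rewrite /= normrM.
rewrite (integral_pull_ge0 sG (X := fun w => `|X w|) (Z := fun=> Ex P (fun w => `|X w|)))//.
- rewrite -ExE ?ltry//.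
  by under eq_fun do rewrite mulrC; exact: L1Z.
- exact: measurableT_comp.
- by move=> w; exact: Ex_ge0.
- by move=> A sA; apply: (indep_Ex1 kN) => //; exact: measurableT_comp.
- exact: measurableT_comp.
Qed.

Lemma indep_Ex k X Y : (k < N)%N -> measurable_wrt (gen_vec e [set k]) X ->
  L1 P X -> measurable_wrt (hist e k) Y -> L1 P Y ->
  Ex P (fun w => Y w * X w) = Ex P Y * Ex P X.
Proof.
move=> kN mX LX mY LY.
have sG A : <<s hist e k >> A -> measurable A by apply: hist_measurable; exact: ltnW.
rewrite (Ex_pull sG (X := X) (Z := fun=> Ex P X) LX (L1_cst P _) _ mY).
- by under eq_Ex do rewrite mulrC; rewrite ExZ// mulrC.
- by move=> A sA; exact: (indep_Ex1 kN).
- exact: indep_L1 kN mX LX mY LY.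
- by under eq_fun do rewrite mulrC; exact: L1Z.
Qed.

End Independence.

(** * Scalar products of column vectors *)

Definition dot {R : realType} {n : nat} (x y : 'cV[R]_n) : R := (x^T *m y) 0 0.

Lemma dotE (R : realType) n (x y : 'cV[R]_n) : dot x y = \sum_i x i 0 * y i 0.
Proof. by rewrite /dot mxE; apply: eq_bigr => i _; rewrite mxE. Qed.

Lemma dotC (R : realType) n (x y : 'cV[R]_n) : dot x y = dot y x.
Proof. by rewrite !dotE; apply: eq_bigr => i _; rewrite mulrC. Qed.

Lemma dotDr (R : realType) n (x y z : 'cV[R]_n) : dot x (y + z) = dot x y + dot x z.
Proof. by rewrite /dot mulmxDr mxE. Qed.

Lemma dotZr (R : realType) n c (x y : 'cV[R]_n) : dot x (c *: y) = c * dot x y.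
Proof. by rewrite /dot -scalemxAr mxE. Qed.

Lemma dotNr (R : realType) n (x y : 'cV[R]_n) : dot x (- y) = - dot x y.
Proof. by rewrite /dot mulmxN mxE. Qed.

Lemma dotBr (R : realType) n (x y z : 'cV[R]_n) : dot x (y - z) = dot x y - dot x z.
Proof. by rewrite dotDr dotNr. Qed.

Lemma dotZl (R : realType) n c (x y : 'cV[R]_n) : dot (c *: x) y = c * dot x y.
Proof. by rewrite dotC dotZr dotC. Qed.

Lemma dotDl (R : realType) n (x y z : 'cV[R]_n) : dot (x + y) z = dot x z + dot y z.
Proof. by rewrite dotC dotDr ![dot z _]dotC. Qed.

Lemma dot0r (R : realType) n (x : 'cV[R]_n) : dot x 0 = 0.
Proof. by rewrite -(scale0r 0) dotZr mul0r. Qed.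

Lemma dot_mul (R : realType) n (x y z : 'cV[R]_n) : dot x (y *m (y^T *m z)) = dot x y * dot y z.
Proof.
rewrite /dot mulmxA [LHS]mxE big_ord1; congr (_ * _).
Qed.

(** * Moments of the excess returns against variables known from the past *)

Section Moments.
Context {R : realType} {d : measure_display} {Omega : measurableType d}.
Variable P : probability Omega R.
Variables (N p0 : nat) (s : nat -> R) (e : nat -> Omega -> 'cV[R]_p0).
Hypothesis e_L2 : forall k i, (k < N)%N -> (fun w => e k w i 0) \in Lfun P 2%:E.
Hypothesis e_indep : independent_vecs P N e.

Let e_meas k i : (k < N)%N -> measurable_fun setT (fun w => e k w i 0).
Proof. by move=> /(e_L2 i) /L2_measurable. Qed.

Local Notation Th := (Theta s e).
Local Notation l2k k := (l2 P (hist e k)).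
Local Notation l2v k := (l2_vec P (hist e k)).
Local Notation E := (Ex P).
Implicit Types (u v h F : Omega -> 'cV[R]_p0) (X Y : Omega -> R).

Definition mean k : 'cV[R]_p0 := \col_i E (fun w => Th k w i 0).
(** The matrix of the expectations of products of entries of [Theta_k], as [moment2E] shows:
    subtracting the constant [s k] does not change the covariance. In this form its rank-one excess
    over the covariance is visible. *)
Definition moment2 k : 'M[R]_p0 := cov_mx P (e k) + mean k *m (mean k)^T.

Lemma Theta_i k w i : Th k w i 0 = e k w i 0 - s k.
Proof. by rewrite /Theta !mxE. Qed.

Lemma Theta_wrt k i : measurable_wrt (gen_vec e [set k]) (fun w => Th k w i 0).
Proof.
under eq_fun do rewrite Theta_i.
by apply: measurable_funB; [exact: gen_vec_wrt|exact: measurable_cst].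
Qed.

Lemma Theta_wrt_hist k i : measurable_wrt (hist e k.+1) (fun w => Th k w i 0).
Proof.
apply: measurable_wrtS (@Theta_wrt k i); apply: gen_vecS => l /= ->; exact: ltnSn.
Qed.

Lemma Theta_L2 k i : (k < N)%N -> L2 P (fun w => Th k w i 0).
Proof.
move=> kN; under eq_fun do rewrite Theta_i.
by apply: L2B; [exact: e_L2|exact: L2_cst].
Qed.

Lemma moment2E k i j : (k < N)%N -> E (fun w => Th k w i 0 * Th k w j 0) = moment2 k i j.
Proof.
move=> kN; rewrite /moment2 !mxE big_ord1 !mxE.
have Li := Theta_L2 i kN; have Lj := Theta_L2 j kN.
have m l : E (fun w => Th k w l 0) = E (fun w => e k w l 0) - s k.
  under eq_Ex do rewrite Theta_i.
  by rewrite ExB ?Ex_cst//; [exact/L2_L1/e_L2|exact: L1_cst].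
have -> : fine (covariance P (fun w => e k w i 0) (fun w => e k w j 0)) =
  E (fun w => (Th k w i 0 - E (fun w => Th k w i 0)) * (Th k w j 0 - E (fun w => Th k w j 0))).
  rewrite covariance.unlock expectation.unlock; congr fine; apply: eq_integral => w _ /=.
  rewrite !m !Theta_i; congr EFin; rewrite /Ex /Rintegral.
  rewrite -[LHS]/((e k w i 0 - fine (\int[P]_x (e k x i 0)%:E)) *
    (e k w j 0 - fine (\int[P]_x (e k x j 0)%:E))).
  ring.
set a := E (fun w => Th k w i 0); set b := E (fun w => Th k w j 0).
have -> : E (fun w => (Th k w i 0 - a) * (Th k w j 0 - b)) =
  E (fun w => Th k w i 0 * Th k w j 0 - b * Th k w i 0 - a * Th k w j 0 + a * b).
  by apply: eq_Ex => w; ring.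
have L := L1M Li Lj; have Li1 := L2_L1 Li; have Lj1 := L2_L1 Lj.
rewrite ExD ?ExB ?ExZ ?Ex_cst -/a -/b.
ring.
all: do ?[exact: L1_cst | apply: L1B | apply: L1Z | assumption].
Qed.

(** Neither factor is bounded; the square of the product is integrable because the two squares are
    integrable and independent. *)
Lemma ThetaM_l2 k i Y : (k < N)%N -> l2k k Y -> l2k k.+1 (fun w => Th k w i 0 * Y w).
Proof.
move=> kN [mY LY]; have mY' : measurable_wrt (hist e k.+1) Y.
  by apply: measurable_wrtS mY; apply: gen_vecS => l /= /ltn_trans; apply.
have mTY : measurable_wrt (hist e k.+1) (fun w => Th k w i 0 * Y w).
  by apply: measurable_funM => //; exact: Theta_wrt_hist.
split => //; apply: L2P.
  apply: measurable_wrtW mTY => A; exact: (hist_measurable e_meas).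
under eq_fun do rewrite mulrC exprMn.
apply: (indep_L1 e_meas e_indep kN).
- by apply: measurable_funX; exact: Theta_wrt.
- by apply: L1M; exact: Theta_L2.
- exact: measurable_funX.
- exact: L1M.
Qed.

Lemma Ex_Theta1 k i X Y : (k < N)%N -> l2k k X -> l2k k Y ->
  E (fun w => Th k w i 0 * X w * Y w) = mean k i 0 * E (fun w => X w * Y w).
Proof.
move=> kN [mX LX] [mY LY]; rewrite /mean mxE mulrC.
rewrite -(indep_Ex e_meas e_indep kN).
- by apply: eq_Ex => w; ring.
- exact: Theta_wrt.
- exact/L2_L1/Theta_L2.
- exact: measurable_funM.
- exact: L1M.
Qed.

Lemma Ex_Theta2 k i j X Y : (k < N)%N -> l2k k X -> l2k k Y ->
  E (fun w => (Th k w i 0 * X w) * (Th k w j 0 * Y w)) = moment2 k i j * E (fun w => X w * Y w).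
Proof.
move=> kN [mX LX] [mY LY]; rewrite -moment2E// mulrC.
rewrite -(indep_Ex e_meas e_indep kN).
- by apply: eq_Ex => w; ring.
- by apply: measurable_funM; exact: Theta_wrt.
- by apply: L1M; exact: Theta_L2.
- exact: measurable_funM.
- exact: L1M.
Qed.

Lemma l2_dot_cst k (c : 'cV[R]_p0) u : l2v k u -> l2k k (fun w => dot c (u w)).
Proof.
by move=> hu; under eq_fun do rewrite dotE; apply: l2_sum => i _; exact: l2Z.
Qed.

Lemma l2_dot_Theta k u : (k < N)%N -> l2v k u -> l2k k.+1 (fun w => dot (Th k w) (u w)).
Proof.
by move=> kN hu; under eq_fun do rewrite dotE; apply: l2_sum => i _; exact: ThetaM_l2.
Qed.

Lemma l2v_cst k (c : 'cV[R]_p0) : l2v k (fun=> c).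
Proof. by move=> i; exact: l2_cst. Qed.

Lemma l2vD k u v : l2v k u -> l2v k v -> l2v k (fun w => u w + v w).
Proof. by move=> hu hv i; under eq_fun do rewrite mxE; exact: l2D. Qed.

Lemma l2vZ k c u : l2v k u -> l2v k (fun w => c *: u w).
Proof. by move=> hu i; under eq_fun do rewrite mxE; exact: l2Z. Qed.

Lemma l2vB k u v : l2v k u -> l2v k v -> l2v k (fun w => u w - v w).
Proof. by move=> hu hv i; under eq_fun do rewrite !mxE; exact: l2B. Qed.

Lemma l2v_mul k (A : 'M[R]_p0) u : l2v k u -> l2v k (fun w => A *m u w).
Proof.
by move=> hu i; under eq_fun do rewrite mxE; apply: l2_sum => j _; exact: l2Z.
Qed.

Lemma l2v_scale k X (c : 'cV[R]_p0) : l2k k X -> l2v k (fun w => X w *: c).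
Proof. by move=> hX i; under eq_fun do rewrite mxE mulrC; exact: l2Z. Qed.

Lemma l2v_indic k A u : (k <= N)%N -> <<s hist e k >> A -> l2v k u ->
  l2v k (fun w => \1_A w *: u w).
Proof.
move=> kN sA hu i; under eq_fun do rewrite mxE.
by apply: l2_indicM => // B; exact: (hist_measurable e_meas).
Qed.

Lemma L1_dot k u v : l2v k u -> l2v k v -> L1 P (fun w => dot (u w) (v w)).
Proof.
move=> hu hv; under eq_fun do rewrite dotE.
by apply: L1_sum => i; exact: L1M (l2_L2 (hu i)) (l2_L2 (hv i)).
Qed.

Lemma l2v_eq0 k F : l2v k F -> (forall h, l2v k h -> E (fun w => dot (h w) (F w)) = 0) ->
  {ae P, forall w, F w = 0}.
Proof.
move=> hF /(_ _ hF) h.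
have F0 w : 0 <= dot (F w) (F w) by rewrite dotE sumr_ge0// => i _; rewrite -expr2 sqr_ge0.
have := Ex_eq0 (L1_dot hF hF) F0 h.
apply: filterS => w /eqP; rewrite dotE psumr_eq0; last by move=> i _; rewrite -expr2 sqr_ge0.
move=> /allP Fw; apply/colP => i; rewrite mxE.
by have := Fw i (mem_index_enum i); rewrite /= mulf_eq0 orbb => /eqP.
Qed.

Lemma Ex_dot_Theta k u Y : (k < N)%N -> l2v k u -> l2k k Y ->
  E (fun w => dot (Th k w) (u w) * Y w) = E (fun w => dot (mean k) (u w) * Y w).
Proof.
move=> kN hu hY.
transitivity (\sum_i E (fun w => Th k w i 0 * u w i 0 * Y w)).
  rewrite -Ex_sum; first by apply: eq_Ex => w; rewrite dotE mulr_suml.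
  by move=> i; apply: L1M (l2_L2 hY); apply: l2_L2 (ThetaM_l2 _ _ _).
transitivity (\sum_i E (fun w => mean k i 0 * (u w i 0 * Y w))).
  apply: eq_bigr => i _; rewrite Ex_Theta1// ExZ//.
  exact: L1M (l2_L2 (hu i)) (l2_L2 hY).
rewrite -Ex_sum; last by move=> i; exact: L1Z (L1M (l2_L2 (hu i)) (l2_L2 hY)).
by apply: eq_Ex => w; rewrite dotE mulr_suml; apply: eq_bigr => i _; rewrite mulrA.
Qed.

Lemma Ex_dot_Theta2 k u v : (k < N)%N -> l2v k u -> l2v k v ->
  E (fun w => dot (Th k w) (u w) * dot (Th k w) (v w)) =
  E (fun w => dot (u w) (moment2 k *m v w)).
Proof.
move=> kN hu hv.
have LT i (x : Omega -> 'cV[R]_p0) : l2v k x -> L2 P (fun w => Th k w i 0 * x w i 0).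
  by move=> hx; apply: l2_L2 (ThetaM_l2 _ _ _).
transitivity (\sum_i \sum_j E (fun w => (Th k w i 0 * u w i 0) * (Th k w j 0 * v w j 0))).
  transitivity (\sum_i E (fun w => (Th k w i 0 * u w i 0) * dot (Th k w) (v w))).
    rewrite -Ex_sum; first by apply: eq_Ex => w; rewrite dotE mulr_suml.
    by move=> i; apply: L1M; [exact: LT|exact: l2_L2 (l2_dot_Theta _ _)].
  apply: eq_bigr => i _; rewrite -Ex_sum; last by move=> j; apply: L1M; exact: LT.
  by apply: eq_Ex => w; rewrite dotE mulr_sumr.
have L i j : L1 P (fun w => u w i 0 * v w j 0) by exact: L1M (l2_L2 (hu i)) (l2_L2 (hv j)).
transitivity (\sum_i \sum_j E (fun w => moment2 k i j * (u w i 0 * v w j 0))).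
  apply: eq_bigr => i _; apply: eq_bigr => j _.
  by rewrite Ex_Theta2// ExZ.
transitivity (\sum_i E (fun w => \sum_j moment2 k i j * (u w i 0 * v w j 0))).
  by apply: eq_bigr => i _; rewrite -Ex_sum// => j; exact: L1Z.
rewrite -Ex_sum; last by move=> i; apply: L1_sum => j; exact: L1Z.
apply: eq_Ex => w; rewrite dotE; apply: eq_bigr => i _.
by rewrite mxE mulr_sumr; apply: eq_bigr => j _; ring.
Qed.

End Moments.

(** * The coupled linear system *)

Lemma kernel0_unitmx (F : fieldType) n (A : 'M[F]_n) :
  (forall x : 'cV_n, A *m x = 0 -> x = 0) -> A \in unitmx.
Proof.
move=> h; rewrite -unitmx_tr -row_free_unit; apply: inj_row_free => v vA.
apply: trmx_inj; rewrite trmx0; apply: h.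
by apply: trmx_inj; rewrite trmx_mul trmxK trmx0.
Qed.

Lemma finite_roots (F : realType) (p : {poly F}) : p != 0 -> finite_set [set x | root p x].
Proof.
have [n] := ubnP (size p); elim: n => // n ih in p *; rewrite ltnS => pn p0.
have [[z pz]|none] := pselect (exists z, root p z); last first.
  rewrite (_ : [set x | _] = set0)//; apply/seteqP; split => // x /= px.
  by apply: none; exists x.
have /factor_theorem [q pE] := pz.
have q0 : q != 0 by apply: contra_neq p0 => q0; rewrite pE q0 mul0r.
have sq : (size q < n)%N.
  by apply: leq_trans pn; rewrite pE size_Mmonic ?monicXsubC// size_XsubC addn2.
rewrite (_ : [set x | _] = [set z] `|` [set x | root q x]).
  by rewrite finite_setU; split => //; exact: ih.
apply/seteqP; split => x /=; rewrite pE rootM root_XsubC.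
  by case/orP => [|/eqP]; [right|left].
by case=> [->|->]; rewrite ?eqxx ?orbT.
Qed.

(** The determinant is a polynomial in [x] whose value at 0 is the nonzero determinant of [D]. *)
Lemma finite_det_affine (F : realType) n (B D : 'M[F]_n) : D \in unitmx ->
  finite_set [set x | \det (x *: B + D) = 0].
Proof.
move=> Du; pose p := \det ('X *: map_mx polyC B + map_mx polyC D).
have pE x : p.[x] = \det (x *: B + D).
  rewrite /p -/(horner_eval x _) -det_map_mx; congr (\det _).
  apply/matrixP => i j; rewrite !mxE.
  by rewrite -[LHS]/(('X * (B i j)%:P + (D i j)%:P).[x]) hornerD hornerM hornerX !hornerC.
rewrite (_ : [set x | _] = [set x | root p x]).
  apply: finite_roots; apply: contraTneq Du => p0.
  by rewrite unitmxE -[D]add0r -(scale0r B) -pE p0 horner0 unitr0.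
by apply/seteqP; split => x /=; rewrite -pE => /eqP.
Qed.

Section PosDefinite.
Context {R : realType} {n : nat}.
Implicit Types A : 'M[R]_n.

Lemma qform_dot A x : qform A x = dot x (A *m x).
Proof. by rewrite /dot mulmxA. Qed.

Lemma pos_definite_unit A : pos_definite A -> A \in unitmx.
Proof.
move=> pA; apply: kernel0_unitmx => x Ax; apply/eqP; apply: contraT => /pA.
by rewrite qform_dot Ax dot0r ltxx.
Qed.

Lemma pos_definite_rank1 A (y : 'cV[R]_n) : pos_definite A ->
  pos_definite (A + y *m y^T).
Proof.
move=> pA x x0; rewrite qform_dot mulmxDl dotDr -mulmxA dot_mul [dot y x]dotC.
by rewrite -qform_dot ltr_wpDr ?pA// -expr2 sqr_ge0.
Qed.

End PosDefinite.

Section CoupledSystem.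
Context {R : realType} {n : nat}.
Variables (a lam : R) (th : 'cV[R]_n) (C Phi : 'M[R]_n).
Implicit Types (x y : R) (B : 'M[R]_n) (u v : 'cV[R]_n).

Record coef := Coef { c_rho : R; c_q : R; c_R : R; c_r : R }.

(* The optimality system uses the second moment [M] for [B]; the choice [B := C]
   only serves to control [c_rho (step st x)]. *)
Definition sysmx B (st : coef) x : 'M[R]_(n + n) :=
  block_mx (x *: Phi + (a ^+ 2 * c_rho st) *: B) (- (x *: Phi))
           (- (x *: Phi) + (a ^+ 2 * c_R st) *: C) (x *: Phi + a ^+ 2 *: C).

Let M := C + th *m th^T.

(** In state [y] the first-order system has the solution [y *: gain + offset], with the value of [u]
    in the upper half and that of [v] in the lower half. The lower entry 0 on the right-hand side
    reflects that the condition on [v] does not see the state. *)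
Definition gain st x : 'cV[R]_(n + n) :=
  invmx (sysmx M st x) *m col_mx (- (a * c_rho st) *: th) 0.

Definition offset st x : 'cV[R]_(n + n) :=
  invmx (sysmx M st x) *m
    col_mx (- (a * (c_q st - lam / 2)) *: th) ((lam / 2 * a) *: th).

(** Obtained by inserting the affine solution into the next state [y + a * dot Theta u] and into the
    gain [a * dot Theta v] of the current period, and replacing [Theta] by its mean. *)
Definition step st x : coef :=
  let g := usubmx (gain st x) in let b := usubmx (offset st x) in
  Coef (c_rho st * (1 + a * dot th g))
       (c_q st + c_rho st * a * dot th b)
       (c_R st * (1 + a * dot th g) + a * dot th (dsubmx (gain st x)))
       (c_r st + c_R st * a * dot th b + a * dot th (dsubmx (offset st x))).

Definition regular st : set R :=
  [set x | sysmx M st x \in unitmx /\ sysmx C st x \in unitmx].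

Lemma irregular_finite st : a != 0 -> pos_definite C -> c_rho st != 0 ->
  finite_set (~` regular st).
Proof.
move=> a0 pC r0.
have key B : pos_definite B -> finite_set [set x | sysmx B st x \notin unitmx].
  move=> pB.
  have E x : sysmx B st x = x *: block_mx Phi (- Phi) (- Phi) Phi + sysmx B st 0.
    by rewrite /sysmx scale_block_mx !scale0r add_block_mx !oppr0 !add0r !scalerN addr0.
  (* At [x = 0] the coupling disappears and the matrix is block lower triangular; its diagonal
     blocks are nonzero multiples of [B] and of [C]. *)
  have D : sysmx B st 0 \in unitmx.
    rewrite /sysmx !scale0r oppr0 !add0r unitmxE det_lblock unitrM -!unitmxE.
    rewrite !unitmxZ ?pos_definite_unit ?unitfE ?mulf_neq0 ?expf_neq0//.
  rewrite (_ : [set x | _] =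
    [set x | \det (x *: block_mx Phi (- Phi) (- Phi) Phi + sysmx B st 0) = 0]).
    exact: finite_det_affine.
  by apply/seteqP; split => x /=; rewrite -E unitmxE unitfE ?negbK => /eqP.
have := key M (pos_definite_rank1 th pC); have := key C pC => fC fM.
apply: (@sub_finite_set _ _ ([set x | sysmx M st x \notin unitmx] `|`
  [set x | sysmx C st x \notin unitmx])).
  by move=> x /= /not_andP[]/negP; [left|right].
by rewrite finite_setU.
Qed.

(* If [c_rho (step st x)] vanished, the rank-one term [th *m th^T] by which [M]
   exceeds [C] would cancel the right-hand side defining [gain], so that
   [sysmx C] would annihilate [gain]. *)
Lemma step_rho_neq0 st x : a != 0 -> c_rho st != 0 -> regular st x ->
  c_rho (step st x) != 0.
Proof.
move=> a0 r0 [uM uC]; rewrite /step /= mulf_neq0//.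
set g := gain st x; apply/eqP => E.
have Mg : sysmx M st x *m g = col_mx (- (a * c_rho st) *: th) 0 by rewrite mulKVmx.
have : sysmx C st x *m g = 0.
  move: Mg; rewrite -[g]vsubmxK /sysmx !mul_block_col.
  move=> /eq_col_mx[M1 M2]; rewrite M2.
  rewrite -col_mx0; congr col_mx; move: M1 E; rewrite /M.
  rewrite !mulmxDl -!scalemxAl !mulmxDl -!mulmxA.
  rewrite (mx11_scalar (th^T *m usubmx g)) -/(dot th (usubmx g)) mul_mx_scalar.
  move: (Phi *m _) (C *m _) (_ *m dsubmx g) (dot th _) => p1 p2 p3 t M1 E.
  have {}E : a * t = - 1 by apply/eqP; rewrite -addr_eq0 addrC E.
  move/colP: M1 => M1; apply/colP => i; move: (M1 i); rewrite !mxE => {M1}.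
  move=> M1; apply/eqP; rewrite -(inj_eq (addrI ((a ^+ 2 * c_rho st) * (t * th i 0)))).
  apply/eqP; transitivity (- (a * c_rho st) * th i 0); first by rewrite -M1; ring.
  by rewrite addr0 expr2 -!mulrA [a * (c_rho st * (t * _))]mulrCA [a * (t * _)]mulrA E; ring.
move=> /(congr1 (mulmx (invmx (sysmx C st x)))); rewrite mulKmx// mulmx0 => g0.
by move: E; rewrite g0 linear0 dot0r mulr0 addr0 => /eqP; rewrite oner_eq0.
Qed.

(** Half the gradient of the cost of [u] in its current value, conditioned on the past, with [y] for
    the accrued deviation. The last term comes from the return [Theta] inside the next state meeting
    the [Theta] of the variation, hence [M]. *)
Definition foc1 st x y u v : 'cV[R]_n :=
  x *: (Phi *m (u - v)) + (a * (c_rho st * y + c_q st - lam / 2)) *: th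
  + (c_rho st * a ^+ 2) *: (M *m u).

(** The analogue for [v]. The cost is centred at the current time, so that [Theta] meets its own
    fluctuation: [C] replaces [M], and no term in the state survives. The control [u] enters also
    through the later values of [v], which react to the next state. *)
Definition foc2 st x u v : 'cV[R]_n :=
  x *: (Phi *m (v - u)) + a ^+ 2 *: (C *m v) + (a ^+ 2 * c_R st) *: (C *m u)
  - (lam / 2 * a) *: th.

(** The pair of residuals is the system matrix applied to the difference between [(u, v)] and the
    affine solution, so it vanishes exactly when that difference does. *)
Lemma foc_solve st x y u v : regular st x ->
  (foc1 st x y u v = 0 /\ foc2 st x u v = 0) <->
  (u = y *: usubmx (gain st x) + usubmx (offset st x) /\
   v = y *: dsubmx (gain st x) + dsubmx (offset st x)).
Proof.
move=> [uM _].
have E : col_mx (foc1 st x y u v) (foc2 st x u v) = sysmx M st x *m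
   (col_mx u v - (y *: gain st x + offset st x)).
  rewrite mulmxBr mulmxDr -scalemxAr !mulKVmx// scale_col_mx add_col_mx.
  rewrite /sysmx mul_block_col opp_col_mx add_col_mx /foc1 /foc2.
  rewrite !(mulmxDl (x *: Phi)) (mulmxDl (- (x *: Phi))) !mulNmx -!scalemxAl !mulmxBr.
  move: (Phi *m u) (Phi *m v) (M *m u) (C *m v) (C *m u) => p1 p2 p3 p4 p5.
  by congr col_mx; apply/colP => i; rewrite !mxE; ring.
have sol : y *: gain st x + offset st x =
  col_mx (y *: usubmx (gain st x) + usubmx (offset st x))
         (y *: dsubmx (gain st x) + dsubmx (offset st x)).
  by rewrite -{1}[gain st x]vsubmxK -{1}[offset st x]vsubmxK scale_col_mx add_col_mx.
split.
  move=> [f1 f2]; move: E; rewrite f1 f2 col_mx0 => /esym E.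
  have := congr1 (mulmx (invmx (sysmx M st x))) E.
  by rewrite mulKmx// mulmx0 => /eqP; rewrite subr_eq0 sol => /eqP/eq_col_mx.
move=> [uE vE]; apply: eq_col_mx.
by rewrite E sol -uE -vE subrr mulmx0 col_mx0.
Qed.

End CoupledSystem.

(** * First-order conditions *)

Section OneStep.
Context {R : realType} {d : measure_display} {Omega : measurableType d}.
Variable P : probability Omega R.
Variables (N p0 : nat) (s : nat -> R) (e : nat -> Omega -> 'cV[R]_p0).
Hypothesis e_L2 : forall k i, (k < N)%N -> (fun w => e k w i 0) \in Lfun P 2%:E.
Hypothesis e_indep : independent_vecs P N e.

Local Notation Th := (Theta s e).
Local Notation l2k k := (l2 P (hist e k)).
Local Notation l2v k := (l2_vec P (hist e k)).
Local Notation E := (Ex P).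
Local Notation mean := (mean P s e).
Implicit Types (u v h F : Omega -> 'cV[R]_p0) (X Y : Omega -> R).

(* The conditional expectations of the terminal deviation [xi] and of the
   future gain [V] given the past of time [k] are affine in the state [Z]. *)
Definition affine_proj k (st : @coef R) (Z xi V : Omega -> R) : Prop :=
  (forall Y, l2k k Y -> E (fun w => xi w * Y w) =
     E (fun w => (c_rho st * Z w + c_q st) * Y w)) /\
  (forall Y, l2k k Y -> E (fun w => V w * Y w) =
     E (fun w => (c_R st * Z w + c_r st) * Y w)).

Variables (k : nat) (a lam x : R) (Phi : 'M[R]_p0) (st : @coef R).
Variables (u v : Omega -> 'cV[R]_p0) (Z xi V : Omega -> R).
Hypothesis kN : (k < N)%N.
Hypotheses (hu : l2v k u) (hv : l2v k v) (hZ : l2k k Z).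
Hypotheses (hxi : L2 P xi) (hV : L2 P V).
Let Z1 w := Z w + a * dot (Th k w) (u w).
Hypothesis next : affine_proj k.+1 st Z1 xi V.

Let C := cov_mx P (e k).
Let M := C + mean k *m (mean k)^T.

(** The part of the gain that the past does not predict. It is orthogonal to the past ([Ex_dev1]),
    and pairing with it turns second moments into covariances ([Ex_dev2]). *)
Let dev h w := dot (Th k w) (h w) - dot (mean k) (h w).

Lemma l2_dev h : l2v k h -> l2k k.+1 (dev h).
Proof.
move=> hh; apply: l2B; first exact: (l2_dot_Theta s e_L2 e_indep kN hh).
by apply: l2_histS (leqnSn k) (l2_dot_cst _ hh).
Qed.

Lemma Ex_dev1 h Y : l2v k h -> l2k k Y -> E (fun w => Y w * dev h w) = 0.
Proof.
move=> hh hY; have hT := l2_dot_Theta s e_L2 e_indep kN hh.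
transitivity (E (fun w => dot (Th k w) (h w) * Y w - dot (mean k) (h w) * Y w)).
  by apply: eq_Ex => w; rewrite /dev; ring.
rewrite ExB; last 2 first.
- exact: L1M (l2_L2 hT) (l2_L2 hY).
- exact: L1M (l2_L2 (l2_dot_cst _ hh)) (l2_L2 hY).
by rewrite (Ex_dot_Theta s e_L2 e_indep kN hh hY) subrr.
Qed.

Lemma Ex_dev2 h g : l2v k h -> l2v k g ->
  E (fun w => dot (Th k w) (g w) * dev h w) = E (fun w => dot (h w) (C *m g w)).
Proof.
move=> hh hg; have hT := l2_dot_Theta s e_L2 e_indep kN hh.
have hTg := l2_dot_Theta s e_L2 e_indep kN hg.
have hm := l2_dot_cst (mean k) hh; have hmg := l2_dot_cst (mean k) hg.
transitivity (E (fun w => dot (Th k w) (h w) * dot (Th k w) (g w)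
                          - dot (Th k w) (g w) * dot (mean k) (h w))).
  by apply: eq_Ex => w; rewrite /dev; ring.
rewrite ExB; last 2 first.
- exact: L1M (l2_L2 hT) (l2_L2 hTg).
- exact: L1M (l2_L2 hTg) (l2_L2 hm).
rewrite (Ex_dot_Theta s e_L2 e_indep kN hg hm) (Ex_dot_Theta2 s e_L2 e_indep kN hh hg).
rewrite -ExB; last 2 first.
- by apply: (L1_dot hh); exact: l2v_mul.
- exact: L1M (l2_L2 hmg) (l2_L2 hm).
apply: eq_Ex => w; rewrite /moment2 mulmxDl dotDr -mulmxA dot_mul -/C.
by rewrite [dot (h w) (mean k)]dotC; ring.
Qed.

(** The next state [Z1] contains [Theta_k] itself, so besides the mean there appears a second-moment
    term in [u]. *)
Lemma affine_dot_Theta r q h : l2v k h ->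
  E (fun w => (r * Z1 w + q) * dot (Th k w) (h w)) =
  E (fun w => (r * Z w + q) * dot (mean k) (h w)) +
  r * a * E (fun w => dot (h w) (M *m u w)).
Proof.
move=> hh.
have hT := l2_dot_Theta s e_L2 e_indep kN hh.
have hTu := l2_dot_Theta s e_L2 e_indep kN hu.
have hA : l2k k (fun w => r * Z w + q) by apply: l2D; [exact: l2Z|exact: l2_cst].
transitivity (E (fun w => dot (Th k w) (h w) * (r * Z w + q) +
   r * a * (dot (Th k w) (h w) * dot (Th k w) (u w)))).
  by apply: eq_Ex => w; rewrite /Z1; ring.
rewrite ExD ?ExZ; last 3 first.
- exact: L1M (l2_L2 hT) (l2_L2 hTu).
- exact: L1M (l2_L2 hT) (l2_L2 hA).
- exact: L1Z (L1M (l2_L2 hT) (l2_L2 hTu)).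
rewrite (Ex_dot_Theta s e_L2 e_indep kN hh hA) (Ex_dot_Theta2 s e_L2 e_indep kN hh hu).
by congr (_ + _); apply: eq_Ex => w; rewrite mulrC.
Qed.

Lemma foc1_Ex h : l2v k h ->
  x * E (fun w => dot (h w) (Phi *m (u w - v w)))
  + a * E (fun w => xi w * dot (Th k w) (h w))
  - lam / 2 * a * E (fun w => dot (Th k w) (h w)) =
  E (fun w => dot (h w) (foc1 a lam (mean k) C Phi st x (Z w) (u w) (v w))).
Proof.
move=> hh; have hT := l2_dot_Theta s e_L2 e_indep kN hh.
rewrite next.1// affine_dot_Theta//.
have hc := l2_dot_cst (mean k) hh.
have -> : E (fun w => dot (Th k w) (h w)) = E (fun w => dot (mean k) (h w)).
  have := Ex_dot_Theta s e_L2 e_indep kN hh (l2_cst P (hist e k) 1).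
  under eq_Ex do rewrite mulr1.
  by under [in RHS]eq_Ex do rewrite mulr1.
have hA : l2k k (fun w => c_rho st * Z w + c_q st) by apply: l2D; [exact: l2Z|exact: l2_cst].
transitivity (E (fun w => x * dot (h w) (Phi *m (u w - v w)) +
  a * ((c_rho st * Z w + c_q st) * dot (mean k) (h w)) +
  a * (c_rho st * a) * dot (h w) (M *m u w) -
  lam / 2 * a * dot (mean k) (h w))).
  have L1a : L1 P (fun w => dot (h w) (Phi *m (u w - v w))).
    by apply: (L1_dot hh); apply: l2v_mul; exact: l2vB.
  have L1b := L1M (l2_L2 hA) (l2_L2 hc).
  have L1c : L1 P (fun w => dot (h w) (M *m u w)) by apply: (L1_dot hh); exact: l2v_mul.
  have L1d := L2_L1 (l2_L2 hc).
  rewrite ExB ?ExD ?ExZ //; do ?[exact: L1Z | apply: L1D | exact: L1M].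
  ring.
apply: eq_Ex => w; rewrite /foc1 !dotDr !dotZr [dot (h w) (mean k)]dotC; ring.
Qed.

(** The fluctuation is known at time [k.+1], hence [V] may be replaced by [c_R st * Z1 + c_r st]. Of
    this only the contribution of [Theta_k] to [Z1] survives, the rest being known at time [k] and
    orthogonal to the fluctuation. *)
Lemma foc2_Ex h : l2v k h ->
  x * E (fun w => dot (h w) (Phi *m (v w - u w)))
  + a * E (fun w => (a * dot (Th k w) (v w) + V w) *
                    (dot (Th k w) (h w) - dot (mean k) (h w)))
  - lam / 2 * a * E (fun w => dot (Th k w) (h w)) =
  E (fun w => dot (h w) (foc2 a lam (mean k) C Phi st x (u w) (v w))).
Proof.
move=> hh; have hT := l2_dot_Theta s e_L2 e_indep kN hh.
have hTu := l2_dot_Theta s e_L2 e_indep kN hu.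
have hTv := l2_dot_Theta s e_L2 e_indep kN hv.
have hD := l2_dev hh.
have hA : l2k k (fun w => c_R st * Z w + c_r st) by apply: l2D; [exact: l2Z|exact: l2_cst].
have -> : E (fun w => (a * dot (Th k w) (v w) + V w) *
              (dot (Th k w) (h w) - dot (mean k) (h w))) =
    a * E (fun w => dot (h w) (C *m v w)) + c_R st * a * E (fun w => dot (h w) (C *m u w)).
  transitivity (E (fun w => a * (dot (Th k w) (v w) * dev h w) + V w * dev h w)).
    by apply: eq_Ex => w; rewrite /dev; ring.
  rewrite ExD ?ExZ; last 3 first.
  - exact: L1M (l2_L2 hTv) (l2_L2 hD).
  - exact: L1Z (L1M (l2_L2 hTv) (l2_L2 hD)).
  - exact: L1M hV (l2_L2 hD).
  rewrite Ex_dev2// next.2//; congr (_ + _).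
  transitivity (E (fun w => (c_R st * Z w + c_r st) * dev h w +
    c_R st * a * (dot (Th k w) (u w) * dev h w))).
    by apply: eq_Ex => w; rewrite /Z1; ring.
  rewrite ExD ?ExZ; last 3 first.
  - exact: L1M (l2_L2 hTu) (l2_L2 hD).
  - exact: L1M (l2_L2 hA) (l2_L2 hD).
  - exact: L1Z (L1M (l2_L2 hTu) (l2_L2 hD)).
  by rewrite Ex_dev1// Ex_dev2// add0r.
have hc := l2_dot_cst (mean k) hh.
have -> : E (fun w => dot (Th k w) (h w)) = E (fun w => dot (mean k) (h w)).
  have := Ex_dot_Theta s e_L2 e_indep kN hh (l2_cst P (hist e k) 1).
  under eq_Ex do rewrite mulr1.
  by under [in RHS]eq_Ex do rewrite mulr1.
transitivity (E (fun w => x * dot (h w) (Phi *m (v w - u w)) +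
  a * a * dot (h w) (C *m v w) + a * (c_R st * a) * dot (h w) (C *m u w) -
  lam / 2 * a * dot (mean k) (h w))).
  have L1a : L1 P (fun w => dot (h w) (Phi *m (v w - u w))).
    by apply: (L1_dot hh); apply: l2v_mul; exact: l2vB.
  have L1b : L1 P (fun w => dot (h w) (C *m v w)) by apply: (L1_dot hh); exact: l2v_mul.
  have L1c : L1 P (fun w => dot (h w) (C *m u w)) by apply: (L1_dot hh); exact: l2v_mul.
  have L1d := L2_L1 (l2_L2 hc).
  rewrite ExB ?ExD ?ExZ //; do ?[exact: L1Z | apply: L1D].
  ring.
apply: eq_Ex => w; rewrite /foc2 dotBr !dotDr !dotZr [dot (h w) (mean k)]dotC; ring.
Qed.

Hypothesis reg : regular a (mean k) C Phi st x.

Lemma l2v_foc1 : l2v k (fun w => foc1 a lam (mean k) C Phi st x (Z w) (u w) (v w)).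
Proof.
apply: l2vD; first apply: l2vD.
- by apply: l2vZ; apply: l2v_mul; exact: l2vB.
- apply: l2v_scale; apply: l2Z; apply: l2B; last exact: l2_cst.
  by apply: l2D; [exact: l2Z|exact: l2_cst].
- by apply: l2vZ; exact: l2v_mul.
Qed.

Lemma l2v_foc2 : l2v k (fun w => foc2 a lam (mean k) C Phi st x (u w) (v w)).
Proof.
apply: l2vB; last exact: l2v_cst.
apply: l2vD; first apply: l2vD.
- by apply: l2vZ; apply: l2v_mul; exact: l2vB.
- by apply: l2vZ; exact: l2v_mul.
- by apply: l2vZ; exact: l2v_mul.
Qed.

Lemma foc_ae :
  (forall h, l2v k h -> 
     E (fun w => dot (h w) (foc1 a lam (mean k) C Phi st x (Z w) (u w) (v w))) = 0) ->
  (forall h, l2v k h -> 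
     E (fun w => dot (h w) (foc2 a lam (mean k) C Phi st x (u w) (v w))) = 0) ->
  {ae P, forall w,
    u w = Z w *: usubmx (gain a (mean k) C Phi st x) + usubmx (offset a lam (mean k) C Phi st x) /\
    v w = Z w *: dsubmx (gain a (mean k) C Phi st x) + dsubmx (offset a lam (mean k) C Phi st x)}.
Proof.
move=> h1 h2.
have := l2v_eq0 l2v_foc2 h2; have := l2v_eq0 l2v_foc1 h1.
apply: filterS2 => w f1 f2; exact/(foc_solve _ _ _ _ reg).
Qed.

Lemma Ex_dot_ae0 F h : l2v k F -> l2v k h -> {ae P, forall w, F w = 0} ->
  E (fun w => dot (h w) (F w)) = 0.
Proof.
move=> hF hh F0; rewrite -[RHS](Ex_cst P 0); apply: ae_Ex.
- exact: L1_measurable (L1_dot hh hF).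
- exact: measurable_cst.
- by apply: filterS F0 => w ->; rewrite dot0r.
Qed.

Lemma affine_proj_step :
  {ae P, forall w,
    u w = Z w *: usubmx (gain a (mean k) C Phi st x) + usubmx (offset a lam (mean k) C Phi st x) /\
    v w = Z w *: dsubmx (gain a (mean k) C Phi st x) + dsubmx (offset a lam (mean k) C Phi st x)} ->
  affine_proj k (step a lam (mean k) C Phi st x) Z xi
    (fun w => a * dot (Th k w) (v w) + V w).
Proof.
move=> fb.
have aeM (c : 'cV[R]_p0) F1 F2 X Y : l2v k F1 -> l2k k X -> l2k k Y ->
    {ae P, forall w, F1 w = F2 w} -> l2v k F2 ->
    E (fun w => (X w + dot c (F1 w)) * Y w) = E (fun w => (X w + dot c (F2 w)) * Y w).
  move=> hF1 hX hY F12 hF2; apply: ae_Ex.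
  - exact: L1_measurable
      (L1M (L2D (l2_L2 hX) (l2_L2 (l2_dot_cst c hF1))) (l2_L2 hY)).
  - exact: L1_measurable
      (L1M (L2D (l2_L2 hX) (l2_L2 (l2_dot_cst c hF2))) (l2_L2 hY)).
  - by apply: filterS F12 => w ->.
set g1 := usubmx _ in fb; set b1 := usubmx _ in fb.
set g2 := dsubmx _ in fb; set b2 := dsubmx _ in fb.
(* One computation for both recursions: [c = 0] for the deviation, and [c = a] for the future gain,
   which acquires the gain of the current period. *)
have core r q c X Y : l2k k Y -> L2 P X ->
    E (fun w => X w * Y w) = E (fun w => (r * Z1 w + q) * Y w) ->
    E (fun w => (c * dot (Th k w) (v w) + X w) * Y w) =
    E (fun w => (r * Z w + q + dot (mean k)
      ((r * a) *: (Z w *: g1 + b1) + c *: (Z w *: g2 + b2))) * Y w).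
  move=> hY LX XE.
  have hTv := l2_dot_Theta s e_L2 e_indep kN hv.
  have hTu := l2_dot_Theta s e_L2 e_indep kN hu.
  have hmu := l2_dot_cst (mean k) hu; have hmv := l2_dot_cst (mean k) hv.
  have hA : l2k k (fun w => r * Z w + q) by apply: l2D; [exact: l2Z|exact: l2_cst].
  have LA := L1M (l2_L2 hA) (l2_L2 hY).
  have Lv := L1M (l2_L2 hmv) (l2_L2 hY).
  have Lu := L1M (l2_L2 hmu) (l2_L2 hY).
  have LTu := L1M (l2_L2 hTu) (l2_L2 hY).
  have LTv := L1M (l2_L2 hTv) (l2_L2 hY).
  transitivity (E (fun w => c * (dot (Th k w) (v w) * Y w) + X w * Y w)).
    by apply: eq_Ex => w; ring.
  rewrite ExD ?ExZ//; [|exact: L1Z|exact: L1M LX (l2_L2 hY)].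
  rewrite XE (Ex_dot_Theta s e_L2 e_indep kN hv hY).
  have -> : E (fun w => (r * Z1 w + q) * Y w) =
     E (fun w => (r * Z w + q) * Y w + r * a * (dot (mean k) (u w) * Y w)).
    transitivity (E (fun w => (r * Z w + q) * Y w + r * a * (dot (Th k w) (u w) * Y w))).
      by apply: eq_Ex => w; rewrite /Z1; ring.
    rewrite ExD ?ExZ//; last exact: L1Z.
    rewrite (Ex_dot_Theta s e_L2 e_indep kN hu hY) -ExZ// -ExD//.
    exact: L1Z.
  rewrite -ExZ// -ExD//; [|exact: L1Z|by apply: L1D => //; exact: L1Z].
  rewrite -(aeM (mean k) (fun w => (r * a) *: u w + c *: v w) _ (fun w => r * Z w + q) Y)//.
  - by apply: eq_Ex => w; rewrite dotDr !dotZr; ring.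
  - by apply: l2vD; exact: l2vZ.
  - by apply: filterS fb => w [-> ->].
  - by apply: l2vD; apply: l2vZ; apply: l2vD; do ?[exact: l2v_scale|exact: l2v_cst].
split => Y hY; have hY1 := l2_histS (leqnSn k) hY.
  have := core (c_rho st) (c_q st) 0 xi Y hY hxi (next.1 Y hY1).
  under eq_Ex do rewrite mul0r add0r.
  move=> ->; apply: eq_Ex => w.
  by rewrite scale0r addr0 dotZr dotDr dotZr /step /= -/g1 -/b1; ring.
rewrite (core (c_R st) (c_r st) a V Y hY hV (next.2 Y hY1)); apply: eq_Ex => w.
by rewrite dotDr !dotZr !dotDr !dotZr /step /= -/g1 -/b1 -/g2 -/b2; ring.
Qed.

End OneStep.

(** * Wealth dynamics and expansion of the cost *)

Section Dynamics.
Context {R : realType} {d : measure_display} {Omega : measurableType d}.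
Variable P : probability Omega R.
Variables (N p0 : nat) (s : nat -> R) (e : nat -> Omega -> 'cV[R]_p0) (lam : R).
Hypothesis e_L2 : forall k i, (k < N)%N -> (fun w => e k w i 0) \in Lfun P 2%:E.
Hypothesis e_indep : independent_vecs P N e.

Local Notation Th := (Theta s e).
Local Notation l2k k := (l2 P (hist e k)).
Local Notation l2v k := (l2_vec P (hist e k)).
Local Notation E := (Ex P).
Implicit Types (u v h : nat -> Omega -> 'cV[R]_p0) (X Y z : Omega -> R).

Let histm k A : (k <= N)%N -> <<s hist e k >> A -> measurable A.
Proof. by apply: hist_measurable => l i /(e_L2 i) /L2_measurable. Qed.

Definition accrual j k : R := \prod_(j <= i < k) s i.

Definition total_gains t u w : R :=
  \sum_(t <= l < N) accrual l.+1 N * dot (Th l w) (u l w).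

Lemma wealthE t z u k w : (t <= k)%N -> wealth s e t z u k w =
  accrual t k * z w + \sum_(t <= l < k) accrual l.+1 k * dot (Th l w) (u l w).
Proof.
elim: k => [|k ih] tk.
  by move: tk; rewrite leqn0 => /eqP ->; rewrite /accrual !big_geq//= mul1r addr0.
move: tk; rewrite leq_eqVlt => /predU1P[->|tk].
  by rewrite /= ltnn /accrual !big_geq// mul1r addr0.
rewrite /= -ltnS tk ih// big_nat_recr//= [accrual k.+1 k.+1]big_geq// mul1r -/(dot _ _).
rewrite mulrDr !mulrA addrA; congr (_ + _).
have acc j : (j <= k)%N -> accrual j k.+1 = s k * accrual j k.
  by move=> jk; rewrite /accrual big_nat_recr//= mulrC.
rewrite acc//; congr (_ + _); rewrite mulr_sumr.
by apply: eq_big_nat => l /andP[_ lk]; rewrite acc// mulrA.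
Qed.

Local Notation gains := total_gains.

Lemma wealth_gains t z u w : (t <= N)%N ->
  wealth s e t z u N w = accrual t N * z w + gains t u w.
Proof. exact: wealthE. Qed.

Lemma wealth_l2 t z u k : (t <= k <= N)%N -> l2k t z -> admissible P N e t u ->
  l2k k (wealth s e t z u k).
Proof.
move=> + hz hu; elim: k => [|k ih] /andP[tk kN].
  by move: tk hz {hu}; rewrite leqn0 => /eqP ->.
move: tk; rewrite leq_eqVlt => /predU1P[tk|tk]; first by move: hz; rewrite tk /= ltnn.
rewrite /= -ltnS tk; apply: l2D.
  by apply: l2Z; apply: (l2_histS (leqnSn k)); apply: ih; rewrite (ltnW kN) andbT -ltnS.
by apply: (l2_dot_Theta s e_L2 e_indep kN); apply: hu; rewrite kN andbT -ltnS.
Qed.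


(** The gains are the terminal wealth started from zero. *)
Lemma gains_L2 t u : (t <= N)%N -> admissible P N e t u -> L2 P (gains t u).
Proof.
move=> tN hu; have := wealth_l2 (k := N) _ (l2_cst P (hist e t) 0) hu.
rewrite tN leqnn => /(_ isT) /l2_L2.
rewrite (_ : wealth _ _ _ _ _ _ = gains t u)//.
by apply/funext => w; rewrite wealth_gains// mulr0 add0r.
Qed.

Lemma gainsD t u h w : gains t (fun l w => u l w + h l w) w = gains t u w + gains t h w.
Proof.
by rewrite /total_gains -big_split/=; apply: eq_bigr => l _; rewrite dotDr mulrDr.
Qed.

Lemma L1_indicM A X : measurable A -> L1 P X -> L1 P (fun w => \1_A w * X w).
Proof.
move=> mA LX; apply: (L1_le _ LX) => [|w].
  by apply: measurable_funM; [exact: measurable_indic|exact: L1_measurable LX].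
by rewrite indicE; case: (_ \in _); rewrite ?mul1r// mul0r normr0.
Qed.

Section ExpandJ.
Variables (t : nat) (z : Omega -> R).
Hypotheses (tN : (t <= N)%N) (hz : l2k t z).

Local Notation Et := (condexp P (hist e t)).
Local Notation W u := (wealth s e t z u N).

Lemma W_L2 u : admissible P N e t u -> L2 P (W u).
Proof. by move=> hu; apply: l2_L2 (wealth_l2 _ hz hu); rewrite tN leqnn. Qed.

Lemma EtP X : L2 P X -> is_proj P (hist e t) X (Et X).
Proof. by move=> LX; apply: condexp_proj => // A; exact: histm. Qed.

Definition deviation u w := W u w - Et (W u) w.

Lemma deviation_L2 u : admissible P N e t u -> L2 P (deviation u).
Proof.
by move=> hu; apply: L2B; [exact: W_L2|exact: l2_L2 (EtP (W_L2 hu)).1].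
Qed.

Lemma deviation_orth u Y : admissible P N e t u -> l2k t Y ->
  E (fun w => deviation u w * Y w) = 0.
Proof.
move=> hu hY; have [h1 h2] := EtP (W_L2 hu).
transitivity (E (fun w => W u w * Y w - Et (W u) w * Y w)).
  by apply: eq_Ex => w; rewrite /deviation mulrBl.
rewrite ExB ?h2 ?subrr//; [exact: L1M (W_L2 hu) (l2_L2 hY)|exact: L1M (l2_L2 h1) (l2_L2 hY)].
Qed.

Lemma J_condexp u : admissible P N e t u ->
  [/\ measurable_wrt (hist e t) (J P N s e lam t z u), L1 P (J P N s e lam t z u) &
   forall A, <<s hist e t >> A -> E (fun w => \1_A w * J P N s e lam t z u w) =
     E (fun w => \1_A w * deviation u w ^+ 2) - lam * E (fun w => \1_A w * W u w)].
Proof.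
move=> hu; have LW := W_L2 hu; have hd := deviation_L2 hu.
have LD : L1 P (fun w => deviation u w ^+ 2) by exact: L1M.
have sG A : <<s hist e t >> A -> measurable A by exact: histm.
have c1 := condexpP sG LD; have c2 := condexpP sG (L2_L1 LW).
have [_ m1 i1 _] := c1; have [_ m2 i2 _] := c2.
split.
- by apply: measurable_funB => //; apply: measurable_funM => //; exact: measurable_cst.
- by apply: L1B => //; exact: L1Z.
move=> A sA; have mA := sG _ sA.
rewrite -(condexp_Ex sG c1 sA) -(condexp_Ex sG c2 sA) -ExZ -?ExB.
- by apply: eq_Ex => w; rewrite /J /E_ /deviation; ring.
all: by do ?[apply: L1Z | apply: L1_indicM].
Qed.

(** An exact second-order expansion, whose quadratic part is the conditional variance of the gains
    of [h]. The cross term with [H] vanishes because the deviation is orthogonal to the past of [t].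
    Any version [H] of the projection is allowed, so that multiples of one version can be used for
    multiples of [h]. *)
Lemma J_expansion u h H A : admissible P N e t u -> admissible P N e t h ->
  is_proj P (hist e t) (gains t h) H -> <<s hist e t >> A ->
  E (fun w => \1_A w * J P N s e lam t z (fun l w => u l w + h l w) w) =
  E (fun w => \1_A w * J P N s e lam t z u w) +
  E (fun w => \1_A w * (gains t h w - H w) ^+ 2) +
  2 * E (fun w => deviation u w * (\1_A w * gains t h w)) -
  lam * E (fun w => \1_A w * gains t h w).
Proof.
move=> hu hh pH sA; have mA := histm tN sA.
have huh : admissible P N e t (fun l w => u l w + h l w).
  by move=> k hk; apply: l2vD; [exact: hu|exact: hh].
have [_ _ ->//] := J_condexp huh; have [_ _ ->//] := J_condexp hu.
have LW := W_L2 hu; have Lg := gains_L2 tN hh; have Ld := deviation_L2 hu.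
have LH := l2_L2 pH.1.
have WE w : W (fun l w => u l w + h l w) w = W u w + gains t h w.
  by rewrite !wealth_gains// gainsD addrA.
(* Versions chosen by [condexp] need not be additive; the sum of the projections is a projection of
   the sum, and this gives additivity almost surely. *)
have pW : is_proj P (hist e t) (W (fun l w => u l w + h l w)) (fun w => Et (W u) w + H w).
  have [h1 h2] := EtP LW; split => [|Y hY]; first exact: l2D pH.1.
  transitivity (E (fun w => W u w * Y w + gains t h w * Y w)).
    by apply: eq_Ex => w; rewrite WE mulrDl.
  have LY := l2_L2 hY; have L1h := l2_L2 h1.
  rewrite ExD ?h2 ?(pH.2 Y hY) -?ExD//; do ?exact: L1M.
  by apply: eq_Ex => w; rewrite mulrDl.
have := is_proj_ae (W_L2 huh) (EtP (W_L2 huh)) pW => aeW.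
have -> : E (fun w => \1_A w * deviation (fun l w => u l w + h l w) w ^+ 2) =
   E (fun w => \1_A w * (deviation u w + (gains t h w - H w)) ^+ 2).
  have Ldd : L2 P (fun w => deviation u w + (gains t h w - H w)) by apply: L2D => //; exact: L2B.
  have Ldh := deviation_L2 huh.
  apply: ae_Ex.
  - by apply/L1_measurable/L1_indicM => //; exact: L1M.
  - by apply/L1_measurable/L1_indicM => //; exact: L1M.
  - by apply: filterS aeW => w; rewrite /deviation WE => ->; congr (_ * _ ^+ 2); ring.
have LgH : L2 P (fun w => gains t h w - H w) by exact: L2B.
have hAH : l2k t (fun w => \1_A w * H w).
  by apply: l2_indicM pH.1 => // B; exact: histm.
have LAg : L2 P (fun w => \1_A w * gains t h w).
  apply: (@L2_bounded _ _ _ _ 1) => // w.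
  by rewrite indicE; case: (_ \in _); rewrite ?normr0 ?normr1.
have L_1 : L1 P (fun w => \1_A w * deviation u w ^+ 2) by apply: L1_indicM => //; exact: L1M.
have L_2 : L1 P (fun w => \1_A w * (gains t h w - H w) ^+ 2) by apply: L1_indicM => //; exact: L1M.
have L_3 := L1M Ld LAg; have L_4 := L1M Ld (l2_L2 hAH).
have -> : E (fun w => \1_A w * (deviation u w + (gains t h w - H w)) ^+ 2) =
  E (fun w => \1_A w * deviation u w ^+ 2 + \1_A w * (gains t h w - H w) ^+ 2 +
     2 * (deviation u w * (\1_A w * gains t h w)) - 2 * (deviation u w * (\1_A w * H w))).
  by apply: eq_Ex => w; ring.
have -> : E (fun w => \1_A w * W (fun l w => u l w + h l w) w) =
   E (fun w => \1_A w * W u w) + E (fun w => \1_A w * gains t h w).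
  rewrite -ExD; [|exact: (L1_indicM mA (L2_L1 LW))|exact: L2_L1].
  by apply: eq_Ex => w; rewrite WE; ring.
rewrite ExB ?ExD ?ExZ//; do ?[exact: L1Z | apply: L1D].
by rewrite (deviation_orth hu hAH); ring.
all: by [].
Qed.

End ExpandJ.

End Dynamics.

(** * Backward recursion of the coefficients and closed-loop trajectories *)

Section Trajectories.
Context {R : realType} {d : measure_display} {Omega : measurableType d}.
Variable P : probability Omega R.
Variables (N p0 : nat) (s : nat -> R) (e : nat -> Omega -> 'cV[R]_p0) (lam : R).
Variable Phi : nat -> 'M[R]_p0.
Hypothesis e_L2 : forall k i, (k < N)%N -> (fun w => e k w i 0) \in Lfun P 2%:E.
Hypothesis e_indep : independent_vecs P N e.

Local Notation Th := (Theta s e).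
Local Notation l2k k := (l2 P (hist e k)).
Local Notation l2v k := (l2_vec P (hist e k)).
Local Notation E := (Ex P).
Local Notation mean := (mean P s e).
Local Notation C k := (cov_mx P (e k)).
Local Notation gains := (total_gains N s e).
Local Notation a k := (accrual s k.+1 N).

(** The terminal value says that at time [N] the deviation is its own conditional expectation and
    that no gain is left. *)
Definition coefs (mu : nat -> R) (k : nat) : @coef R :=
  foldr (fun j st => step (a j) lam (mean j) (C j) (Phi j) st (mu j))
    (Coef 1 0 0 0) (iota k (N - k)).

Lemma coefsN mu : coefs mu N = Coef 1 0 0 0.
Proof. by rewrite /coefs subnn. Qed.

Lemma coefsS mu k : (k < N)%N ->
  coefs mu k = step (a k) lam (mean k) (C k) (Phi k) (coefs mu k.+1) (mu k).
Proof. by move=> kN; rewrite /coefs -subnSK. Qed.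

(** This is the reason why the exceptional set for [mu k], built from [coefs mu k.+1], depends on
    later parameters only. *)
Lemma eq_coefs mu mu' k : (forall j, (k <= j < N)%N -> mu j = mu' j) ->
  coefs mu k = coefs mu' k.
Proof.
move=> h; have : all (fun j => (k <= j < N)%N) (iota k (N - k)).
  apply/allP => j; rewrite mem_iota => /andP[kj jN]; rewrite kj/=.
  have [kN|Nk] := leqP k N; first by rewrite subnKC in jN.
  by move: jN; rewrite (eqP (ltnW Nk : (N - k == 0)%N)) addn0 ltnNge kj.
have gen (T : Type) (f : nat -> T -> R -> T) (st : T) (r : seq nat) :
    all (fun j => (k <= j < N)%N) r ->
    foldr (fun j st => f j st (mu j)) st r = foldr (fun j st => f j st (mu' j)) st r.
  elim: r => [|j r ih] /=; first by [].
  by move=> /andP[/h -> /ih ->].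
exact: (gen _ (fun j => step (a j) lam (mean j) (C j) (Phi j))).
Qed.

Lemma gains_recl k v w : (k < N)%N ->
  gains k v w = a k * dot (Th k w) (v k w) + gains k.+1 v w.
Proof. by move=> kN; rewrite /total_gains big_ltn. Qed.

Variable mu : nat -> R.
Hypothesis mu_reg : forall k, (k < N)%N ->
  regular (a k) (mean k) (C k) (Phi k) (coefs mu k.+1) (mu k).

Let gn k := gain (a k) (mean k) (C k) (Phi k) (coefs mu k.+1) (mu k).
Let os k := offset (a k) lam (mean k) (C k) (Phi k) (coefs mu k.+1) (mu k).

Definition fb_u k (y : R) : 'cV[R]_p0 := y *: usubmx (gn k) + usubmx (os k).
Definition fb_v k (y : R) : 'cV[R]_p0 := y *: dsubmx (gn k) + dsubmx (os k).

Section Stationarity.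
Variables (t : nat) (u v : nat -> Omega -> 'cV[R]_p0) (xi : nat -> Omega -> R).
Hypotheses (tN : (t <= N)%N) (hu : admissible P N e t u) (hv : admissible P N e t v).
Hypothesis xi_t : l2k t (xi t).
Hypothesis xiS : forall k, (t <= k < N)%N -> forall w,
  xi k.+1 w = xi k w + a k * dot (Th k w) (u k w).

(** The derivative is written with [xi N] in place of the deviation of the wealth. Only the
    recursion of [xi] is assumed, so that [xi] can be the constructed closed-loop process
    (existence) or the true deviation of a given solution (uniqueness). *)
Definition stationary_u k : Prop := forall h, l2v k h ->
  mu k * E (fun w => dot (h w) (Phi k *m (u k w - v k w)))
  + a k * E (fun w => xi N w * dot (Th k w) (h w))
  - lam / 2 * a k * E (fun w => dot (Th k w) (h w)) = 0.

(** The gains from time [k] on, tested against the fluctuation, replace the deviation;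
    [deviation_dot_Theta] justifies this. *)
Definition stationary_v k : Prop := forall h, l2v k h ->
  mu k * E (fun w => dot (h w) (Phi k *m (v k w - u k w)))
  + a k * E (fun w => gains k v w * (dot (Th k w) (h w) - dot (mean k) (h w)))
  - lam / 2 * a k * E (fun w => dot (Th k w) (h w)) = 0.

Definition feedback k : Prop :=
  {ae P, forall w, u k w = fb_u k (xi k w) /\ v k w = fb_v k (xi k w)}.

Lemma xi_l2 k : (t <= k <= N)%N -> l2k k (xi k).
Proof.
elim: k => [|k ih] /andP[tk kN].
  by move: tk xi_t; rewrite leqn0 => /eqP ->.
move: tk; rewrite leq_eqVlt => /predU1P[<-//|tk].
have tkN : (t <= k < N)%N by rewrite kN andbT -ltnS.
rewrite (_ : xi k.+1 = fun w => xi k w + a k * dot (Th k w) (u k w)).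
  apply: l2D; first by apply: (l2_histS (leqnSn k)); apply: ih; rewrite (ltnW kN) andbT -ltnS.
  by apply: l2Z; apply: (l2_dot_Theta s e_L2 e_indep kN); exact: hu.
by apply/funext => w; exact: xiS.
Qed.

Lemma affine_projN : affine_proj P e N (coefs mu N) (xi N) (xi N) (gains N v).
Proof.
rewrite coefsN; split => Y hY; apply: eq_Ex => w; first by rewrite /= mul1r addr0.
by rewrite /total_gains big_geq//= !mul0r addr0 mul0r.
Qed.

Let xi_step k : (t <= k < N)%N ->
  xi k.+1 = fun w => xi k w + a k * dot (Th k w) (u k w).
Proof. by move=> tkN; apply/funext => w; exact: xiS. Qed.

Let gains_step k : (k < N)%N ->
  gains k v = fun w => a k * dot (Th k w) (v k w) + gains k.+1 v w.
Proof. by move=> kN; apply/funext => w; exact: gains_recl. Qed.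

Let admS k (x : nat -> Omega -> 'cV[R]_p0) : (t <= k)%N ->
  admissible P N e t x -> admissible P N e k x.
Proof. by move=> tk hx j /andP[kj jN]; apply: hx; rewrite (leq_trans tk kj). Qed.

Let xiN_L2 : L2 P (xi N).
Proof.
have h : (t <= N <= N)%N by rewrite tN leqnn.
exact: l2_L2 (xi_l2 h).
Qed.

Let gnL2 k : (t <= k <= N)%N -> L2 P (gains k v).
Proof.
by move=> /andP[tk kN]; apply: (gains_L2 s e_L2 e_indep kN); exact: admS.
Qed.

(** Once the projections at [k.+1] are affine, stationarity at [k] is the linear system, and its
    affine solution makes the projections at [k] affine again. The two directions are kept separate:
    uniqueness starts from stationarity, existence from the feedback. *)
Lemma one_step k : (t <= k < N)%N ->
  affine_proj P e k.+1 (coefs mu k.+1) (xi k.+1) (xi N) (gains k.+1 v) ->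
  (stationary_u k -> stationary_v k -> feedback k) /\
  (feedback k -> [/\ stationary_u k, stationary_v k &
    affine_proj P e k (coefs mu k) (xi k) (xi N) (gains k v)]).
Proof.
move=> tkN; have /andP[tk kN] := tkN.
rewrite (xi_step tkN) => next.
have hZ : l2k k (xi k) by apply: xi_l2; rewrite tk ltnW.
have huk := hu tkN; have hvk := hv tkN.
have hV : L2 P (gains k.+1 v) by apply: gnL2; rewrite (leq_trans tk (leqnSn k)).
have E1 h (hh : l2v k h) := foc1_Ex e_L2 e_indep lam (mu k) (Phi k) kN huk hvk hZ next hh.
have E2 h (hh : l2v k h) := foc2_Ex e_L2 e_indep lam (mu k) (Phi k) kN huk hvk hZ hV next hh.
split.
  move=> s1 s2; apply: (foc_ae huk hvk hZ (mu_reg kN)).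
  - by move=> h hh; rewrite -E1//; exact: s1.
  - move=> h hh; rewrite -E2//.
    by have := s2 h hh; rewrite gains_step.
move=> fb.
have sol : {ae P, forall w,
    foc1 (a k) lam (mean k) (C k) (Phi k) (coefs mu k.+1) (mu k) (xi k w) (u k w) (v k w) = 0 /\
    foc2 (a k) lam (mean k) (C k) (Phi k) (coefs mu k.+1) (mu k) (u k w) (v k w) = 0}.
  by apply: filterS fb => w uv; apply/(foc_solve lam (xi k w) (u k w) (v k w) (mu_reg kN)).
split.
- move=> h hh; rewrite E1//; apply: Ex_dot_ae0 hh _; first exact: l2v_foc1.
  by apply: filterS sol => w [].
- move=> h hh.
  rewrite gains_step// E2//; apply: Ex_dot_ae0 hh _; first exact: l2v_foc2.
  by apply: filterS sol => w [].
- rewrite coefsS// gains_step//.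
  exact: (affine_proj_step e_L2 e_indep kN huk hvk hZ xiN_L2 hV next fb).
Qed.

Lemma backward_induction (A : nat -> Prop) :
  A N -> (forall k, (t <= k < N)%N -> A k.+1 -> A k) ->
  forall k, (t <= k <= N)%N -> A k.
Proof.
move=> AN AS k /andP[tk kN].
have [n] : exists n, (k + n = N)%N by exists (N - k)%N; rewrite subnKC.
elim: n k tk kN => [|n ih] k tk kN; first by rewrite addn0 => ->.
rewrite -addSnnS => knN; apply: AS; first by rewrite tk -knN leq_addr.
apply: ih => //; [exact: leq_trans tk (leqnSn k)|by rewrite -knN leq_addr].
Qed.

Lemma stationary_feedback :
  (forall k, (t <= k < N)%N -> stationary_u k /\ stationary_v k) ->
  forall k, (t <= k <= N)%N ->
    affine_proj P e k (coefs mu k) (xi k) (xi N) (gains k v) /\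
    ((k < N)%N -> feedback k).
Proof.
move=> st; apply: backward_induction.
  by split; [exact: affine_projN|rewrite ltnn].
move=> k tkN [/(one_step tkN)[nec suf] _].
have [s1 s2] := st k tkN; have fb := nec s1 s2.
by split => //; have [] := suf fb.
Qed.

Lemma feedback_stationary :
  (forall k, (t <= k < N)%N -> feedback k) ->
  (forall k, (t <= k < N)%N -> stationary_u k /\ stationary_v k) /\
  affine_proj P e t (coefs mu t) (xi t) (xi N) (gains t v).
Proof.
move=> fb.
have A k : (t <= k <= N)%N -> affine_proj P e k (coefs mu k) (xi k) (xi N) (gains k v).
  move: k; apply: backward_induction; first exact: affine_projN.
  move=> k tkN next; have [_ suf] := one_step tkN next.
  by have [] := suf (fb k tkN).
split; last by apply: A; rewrite leqnn.
move=> k tkN; have /andP[tk kN] := tkN.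
have := A k.+1; rewrite kN (leq_trans tk (leqnSn k)) => /(_ isT) /(one_step tkN)[_ suf].
by have [] := suf (fb k tkN).
Qed.

End Stationarity.

(** Both state processes obey the same closed-loop recursion, so almost sure equality at time [t]
    propagates forward. *)
Lemma feedback_unique t u v u' v' (xi xi' : nat -> Omega -> R) :
  (forall k, (t <= k < N)%N -> forall w, xi k.+1 w = xi k w + a k * dot (Th k w) (u k w)) ->
  (forall k, (t <= k < N)%N -> forall w, xi' k.+1 w = xi' k w + a k * dot (Th k w) (u' k w)) ->
  (forall k, (t <= k < N)%N -> feedback u v xi k) ->
  (forall k, (t <= k < N)%N -> feedback u' v' xi' k) ->
  {ae P, forall w, xi t w = xi' t w} ->
  forall k, (t <= k < N)%N -> {ae P, forall w, v k w = v' k w}.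
Proof.
move=> xS xS' fb fb' x_t.
have xik k : (t <= k < N)%N -> {ae P, forall w, xi k w = xi' k w}.
  elim: k => [|k ih] tkN; have /andP[tk kN] := tkN.
    by move: tk x_t; rewrite leqn0 => /eqP ->.
  move: tk; rewrite leq_eqVlt => /predU1P[<-//|tk].
  have tkN' : (t <= k < N)%N by rewrite (ltnW kN) andbT -ltnS.
  have := fb' k tkN'; have := fb k tkN'; have := ih tkN'.
  apply: filterS3 => w xx [uE _] [u'E _].
  by rewrite (xS _ tkN') (xS' _ tkN') uE u'E xx.
move=> k tkN; have := fb' k tkN; have := fb k tkN; have := xik k tkN.
by apply: filterS3 => w xx [_ ->] [_ ->]; rewrite xx.
Qed.

(** The state driven by its own feedback. The initial value is a constant because consistency will
    determine it as a deterministic number; the value at times before [t] is a convention. *)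
Fixpoint loop t (c : R) k : Omega -> R :=
  if k is k'.+1 then
    if (t <= k')%N
    then fun w => loop t c k' w + a k' * dot (Th k' w) (fb_u k' (loop t c k' w))
    else fun=> c
  else fun=> c.

Lemma loop_init t c : loop t c t = fun=> c.
Proof. by case: t => //= t; rewrite ltnn. Qed.

Lemma loopS t c k w : (t <= k)%N ->
  loop t c k.+1 w = loop t c k w + a k * dot (Th k w) (fb_u k (loop t c k w)).
Proof. by move=> tk; rewrite /= tk. Qed.

Lemma l2v_fb_u k y : l2k k y -> l2v k (fun w => fb_u k (y w)).
Proof. by move=> hy; apply: l2vD; [exact: l2v_scale|exact: l2v_cst]. Qed.

Lemma l2v_fb_v k y : l2k k y -> l2v k (fun w => fb_v k (y w)).
Proof. by move=> hy; apply: l2vD; [exact: l2v_scale|exact: l2v_cst]. Qed.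

Lemma loop_l2 t c k : (k <= N)%N -> l2k k (loop t c k).
Proof.
elim: k => [|k ih] kN; first exact: l2_cst.
rewrite /=; case: ifP => _; last exact: l2_cst.
have hk := ih (ltnW kN); apply: l2D; first exact: (l2_histS (leqnSn k) hk).
by apply: l2Z; apply: (l2_dot_Theta s e_L2 e_indep kN); exact: l2v_fb_u.
Qed.

End Trajectories.

(** * Quadratic variations of the cost of [u] *)

Lemma linear_coef_eq0 (F : realFieldType) (Q L : F) : 0 <= Q ->
  (forall r : F, 0 <= r ^+ 2 * Q + 2 * (r * L)) -> L = 0.
Proof.
move=> Q0 h; have Q1 : 0 < Q + 1 by rewrite ltr_pwDr.
(* The minimizer would be [- L / Q]; adding 1 to the denominator covers [Q = 0] and still gives a
   negative value unless [L = 0]. *)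
have := h (- L / (Q + 1)).
have -> : (- L / (Q + 1)) ^+ 2 * Q + 2 * (- L / (Q + 1) * L) =
  - (L ^+ 2 * ((Q + 2) / (Q + 1) ^+ 2)) by field; rewrite gt_eqF.
rewrite oppr_ge0 pmulr_lle0; last by rewrite divr_gt0 ?exprn_gt0// ltr_pwDr.
by move=> L2; apply/eqP; rewrite -sqrf_eq0 eq_le L2 sqr_ge0.
Qed.

Section RangeSums.
Context {R : realType} {d : measure_display} {Omega : measurableType d}.
Variable P : probability Omega R.
Variables (m n : nat) (F : nat -> Omega -> R).
Hypothesis LF : forall k, (m <= k < n)%N -> L1 P (F k).

(** Extension by zero, because [L1_sum] and [Ex_sum] require integrability at every index while
    controls are admissible only within the range. *)
Let F' k := if (m <= k < n)%N then F k else fun=> 0.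
Let LF' k : L1 P (F' k).
Proof. by rewrite /F'; case: ifP => [/LF|_] //; exact: L1_cst. Qed.
Let F'E w : \sum_(m <= k < n) F k w = \sum_(m <= k < n) F' k w.
Proof. by apply: eq_big_nat => k kmn; rewrite /F' kmn. Qed.

Lemma L1_sum_nat : L1 P (fun w => \sum_(m <= k < n) F k w).
Proof. by under eq_fun do rewrite F'E; exact: L1_sum. Qed.

Lemma Ex_sum_nat :
  Ex P (fun w => \sum_(m <= k < n) F k w) = \sum_(m <= k < n) Ex P (F k).
Proof.
under eq_Ex do rewrite F'E.
by rewrite Ex_sum//; apply: eq_big_nat => k kmn; rewrite /F' kmn.
Qed.

End RangeSums.

Section Variations.
Context {R : realType} {d : measure_display} {Omega : measurableType d}.
Variable P : probability Omega R.
Variables (N p0 : nat) (s : nat -> R) (e : nat -> Omega -> 'cV[R]_p0) (lam : R).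
Variable Phi : nat -> 'M[R]_p0.
Hypothesis e_L2 : forall k i, (k < N)%N -> (fun w => e k w i 0) \in Lfun P 2%:E.
Hypothesis e_indep : independent_vecs P N e.
Hypothesis Phi_sym : forall k, (k < N)%N -> (Phi k)^T = Phi k.
Variable mu : nat -> R.

Local Notation Th := (Theta s e).
Local Notation l2k k := (l2 P (hist e k)).
Local Notation l2v k := (l2_vec P (hist e k)).
Local Notation E := (Ex P).
Local Notation mean := (mean P s e).
Local Notation gains := (total_gains N s e).
Local Notation a k := (accrual s k.+1 N).
Local Notation adm := (admissible P N e).
Local Notation Ups := (fun k => mu k *: block_mx (Phi k) (- Phi k) (- Phi k) (Phi k)).
Local Notation dev t z u := (deviation P N s e t z u).
Implicit Types (u v h : nat -> Omega -> 'cV[R]_p0) (z : Omega -> R).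

Let histm k A : (k <= N)%N -> <<s hist e k >> A -> measurable A.
Proof. by apply: hist_measurable => l i /(e_L2 i) /L2_measurable. Qed.

Lemma penaltyE u v k w :
  penalty Ups u v k w = mu k * dot (u k w - v k w) (Phi k *m (u k w - v k w)).
Proof. by rewrite /penalty qform_coupling qform_dot. Qed.

Lemma dot_sym k (x y : 'cV[R]_p0) : (k < N)%N -> dot x (Phi k *m y) = dot y (Phi k *m x).
Proof.
move=> kN; rewrite /dot -[RHS]trace_mx11 -mxtrace_tr !trmx_mul trmxK Phi_sym//.
by rewrite mulmxA trace_mx11.
Qed.

Lemma penalty_L1 u v k : l2v k (u k) -> l2v k (v k) -> L1 P (penalty Ups u v k).
Proof.
move=> hu hv.
rewrite (_ : penalty _ _ _ _ = fun w => mu k * dot (u k w - v k w) (Phi k *m (u k w - v k w))).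
  by apply: L1Z; apply: L1_dot; [exact: l2vB|apply: l2v_mul; exact: l2vB].
by apply/funext => w; rewrite penaltyE.
Qed.

(** In the linear term the indicator is attached to the direction [y]: the localized variation is
    again an admissible direction, to which a first-order condition applies. *)
Lemma penalty_expand (x y : Omega -> 'cV[R]_p0) k A : (k < N)%N ->
  <<s hist e k >> A -> l2v k x -> l2v k y ->
  E (fun w => \1_A w * (mu k * dot (x w + y w) (Phi k *m (x w + y w)))) =
  E (fun w => \1_A w * (mu k * dot (x w) (Phi k *m x w))) +
  mu k * E (fun w => \1_A w * dot (y w) (Phi k *m y w)) +
  2 * (mu k * E (fun w => dot (\1_A w *: y w) (Phi k *m x w))).
Proof.
move=> kN sA hx hy; have mA := histm (ltnW kN) sA.
have Lxx : L1 P (fun w => \1_A w * (mu k * dot (x w) (Phi k *m x w))).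
  by apply: L1_indicM => //; apply: L1Z; apply: L1_dot; last exact: l2v_mul.
have Lyy : L1 P (fun w => \1_A w * dot (y w) (Phi k *m y w)).
  by apply: L1_indicM => //; apply: L1_dot; last exact: l2v_mul.
have Lyx : L1 P (fun w => dot (\1_A w *: y w) (Phi k *m x w)).
  by apply: L1_dot (l2v_mul _ hx); apply: (l2v_indic e_L2 (ltnW kN)).
have Lyx2 := L1Z (mu k) Lyx; have Lyx3 := L1Z 2 Lyx2; have Lyy2 := L1Z (mu k) Lyy.
have Lxy := L1D Lxx Lyy2.
rewrite -!ExZ// -!ExD//.
by apply: eq_Ex => w; rewrite dotDl mulmxDr !dotDr dotZl (dot_sym (x w))//; ring.
Qed.

Lemma gains_indic t h A w : \1_A w * gains t h w =
  \sum_(t <= k < N) a k * dot (Th k w) (\1_A w *: h k w).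
Proof.
by rewrite /total_gains mulr_sumr; apply: eq_bigr => k _; rewrite dotZr mulrCA.
Qed.

Section FixedTime.
Variables (t : nat) (z : Omega -> R).
Hypotheses (tN : (t <= N)%N) (hz : l2k t z).

Let admW k u : (t <= k < N)%N -> adm t u -> l2v k (u k).
Proof. by move=> tkN; exact. Qed.

Let indW k h A : (t <= k < N)%N -> adm t h -> <<s hist e t >> A ->
  l2v k (fun w => \1_A w *: h k w).
Proof.
move=> tkN hh sA; have /andP[tk kN] := tkN.
apply: (l2v_indic e_L2 (ltnW kN)) (hh _ tkN).
by apply: gen_vecS sA => l /= /leq_trans; apply.
Qed.

Lemma Jhat_condexp u v : adm t u -> adm t v ->
  [/\ measurable_wrt (hist e t) (Jhat P N s e lam Ups t z u v),
      L1 P (Jhat P N s e lam Ups t z u v) &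
  forall A, <<s hist e t >> A ->
    E (fun w => \1_A w * Jhat P N s e lam Ups t z u v w) =
    \sum_(t <= k < N) E (fun w => \1_A w * penalty Ups u v k w) +
    E (fun w => \1_A w * J P N s e lam t z u w)].
Proof.
move=> hu hv; have [mJ LJ _] := J_condexp s lam e_L2 e_indep tN hz hu.
have sG A : <<s hist e t >> A -> measurable A by exact: histm.
have cp k : (t <= k < N)%N -> is_condexp P (hist e t) (penalty Ups u v k)
    (condexp P (hist e t) (penalty Ups u v k)).
  by move=> tkN; apply: condexpP => //; apply: penalty_L1; exact: admW.
have Lc k : (t <= k < N)%N -> L1 P (condexp P (hist e t) (penalty Ups u v k)).
  by move=> /cp[].
split.
- apply: measurable_funD => //.
  rewrite (_ : (fun _ => _) = fun w => \sum_(k <- index_iota t N)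
     (if (t <= k < N)%N then condexp P (hist e t) (penalty Ups u v k) w else 0)).
    apply: measurable_sum => k.
    case: (boolP (t <= k < N)%N) => [/cp[]//|_]; exact: measurable_cst.
  by apply/funext => w; apply: eq_big_nat => k ->.
- by apply: L1D => //; exact: L1_sum_nat.
- move=> A sA; have mA := sG _ sA.
  transitivity (E (fun w => \sum_(t <= k < N) \1_A w * condexp P (hist e t) (penalty Ups u v k) w
     + \1_A w * J P N s e lam t z u w)).
    by apply: eq_Ex => w; rewrite /Jhat mulrDr mulr_sumr.
  rewrite ExD; last 2 first.
  - by apply: L1_sum_nat => k tkN; apply: L1_indicM => //; exact: Lc.
  - exact: L1_indicM.
  rewrite Ex_sum_nat; last by move=> k tkN; apply: L1_indicM => //; exact: Lc.
  by congr (_ + _); apply: eq_big_nat => k tkN; rewrite (condexp_Ex sG (cp k tkN)).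
Qed.

Definition quad A h (H : Omega -> R) : R :=
  \sum_(t <= k < N) mu k * E (fun w => \1_A w * dot (h k w) (Phi k *m h k w)) +
  E (fun w => \1_A w * (gains t h w - H w) ^+ 2).

(** Half the first-order part of the cost on the event [A]. Each summand is the stationarity
    expression at time [k] for the direction [\1_A w *: h k w]. *)
Definition lin_u A u v h : R :=
  \sum_(t <= k < N)
    (mu k * E (fun w => dot (\1_A w *: h k w) (Phi k *m (u k w - v k w)))
     + a k * E (fun w => dev t z u w * dot (Th k w) (\1_A w *: h k w))
     - lam / 2 * a k * E (fun w => dot (Th k w) (\1_A w *: h k w))).

Lemma Jhat_expansion u v h H A : adm t u -> adm t v -> adm t h ->
  is_proj P (hist e t) (gains t h) H -> <<s hist e t >> A ->
  E (fun w => \1_A w * Jhat P N s e lam Ups t z (fun l w => u l w + h l w) v w) =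
  E (fun w => \1_A w * Jhat P N s e lam Ups t z u v w) +
  quad A h H + 2 * lin_u A u v h.
Proof.
move=> hu hv hh pH sA.
have huh : adm t (fun l w => u l w + h l w).
  by move=> k hk; apply: l2vD; [exact: hu|exact: hh].
have [_ _ ->//] := Jhat_condexp huh hv; have [_ _ ->//] := Jhat_condexp hu hv.
rewrite (J_expansion lam e_L2 e_indep tN hz hu hh pH sA).
have LTh k : (t <= k < N)%N -> L2 P (fun w => dot (Th k w) (\1_A w *: h k w)).
  move=> tkN; have /andP[tk kN] := tkN.
  apply: l2_L2 (l2_dot_Theta s e_L2 e_indep kN _); exact: indW.
have Ld := deviation_L2 s e_L2 e_indep tN hz hu.
have -> : E (fun w => dev t z u w * (\1_A w * gains t h w)) =
  \sum_(t <= k < N) a k * E (fun w => dev t z u w * dot (Th k w) (\1_A w *: h k w)).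
  transitivity (E (fun w =>
      \sum_(t <= k < N) a k * (dev t z u w * dot (Th k w) (\1_A w *: h k w)))).
    by apply: eq_Ex => w; rewrite gains_indic mulr_sumr; apply: eq_bigr => k _; rewrite mulrCA.
  rewrite Ex_sum_nat => [|k tkN]; last by apply: L1Z; exact: L1M Ld (LTh k tkN).
  by apply: eq_big_nat => k tkN; rewrite ExZ//; exact: L1M Ld (LTh k tkN).
have -> : E (fun w => \1_A w * gains t h w) =
  \sum_(t <= k < N) a k * E (fun w => dot (Th k w) (\1_A w *: h k w)).
  under eq_Ex do rewrite gains_indic.
  rewrite Ex_sum_nat => [|k tkN]; last by apply: L1Z; exact: L2_L1 (LTh k tkN).
  by apply: eq_big_nat => k tkN; rewrite ExZ//; exact: L2_L1 (LTh k tkN).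
have -> : \sum_(t <= k < N) E (fun w => \1_A w * penalty Ups (fun l w => u l w + h l w) v k w) =
  \sum_(t <= k < N) (E (fun w => \1_A w * penalty Ups u v k w) +
    mu k * E (fun w => \1_A w * dot (h k w) (Phi k *m h k w)) +
    2 * (mu k * E (fun w => dot (\1_A w *: h k w) (Phi k *m (u k w - v k w))))).
  apply: eq_big_nat => k tkN; have /andP[tk kN] := tkN.
  have sAk : <<s hist e k >> A by apply: gen_vecS sA => l /= /leq_trans; apply.
  under eq_Ex do rewrite penaltyE addrAC.
  under [X in _ = X + _ + _]eq_Ex do rewrite penaltyE.
  by apply: penalty_expand => //; [apply: l2vB|]; exact: admW.
have split3 (x y x' : nat -> R) : \sum_(t <= k < N) (x k + y k + 2 * x' k) =
    \sum_(t <= k < N) x k + \sum_(t <= k < N) y k + 2 * \sum_(t <= k < N) x' k.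
  by rewrite !big_split/= mulr_sumr.
have split3' (x y x' : nat -> R) : \sum_(t <= k < N) (x k + y k - lam / 2 * a k * x' k) =
    \sum_(t <= k < N) x k + \sum_(t <= k < N) y k - lam / 2 * \sum_(t <= k < N) a k * x' k.
  rewrite sumrB big_split/= mulr_sumr; congr (_ - _).
  by apply: eq_bigr => k _; rewrite mulrA.
by rewrite /quad /lin_u split3 split3'; field.
Qed.

End FixedTime.

End Variations.

(** * Minimizers and stationarity *)

Lemma le_Ex_ae (R : realType) d (Omega : measurableType d) (P : probability Omega R)
    (f g : Omega -> R) :
  L1 P f -> L1 P g -> {ae P, forall w, f w <= g w} -> Ex P f <= Ex P g.
Proof.
move=> Lf Lg fg; have Lgf := L1B Lg Lf.
have Lgf' := L1_measurable Lgf.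
rewrite -subr_ge0 -ExB//.
rewrite (@ae_Ex _ _ _ P _ (fun w => `|g w - f w|))//.
- exact: Ex_ge0.
- exact: measurableT_comp.
- by apply: filterS fg => w fgw; rewrite ger0_norm// subr_ge0.
Qed.

Section Minimizers.
Context {R : realType} {d : measure_display} {Omega : measurableType d}.
Variable P : probability Omega R.
Variables (N p0 : nat) (s : nat -> R) (e : nat -> Omega -> 'cV[R]_p0) (lam : R).
Variable Phi : nat -> 'M[R]_p0.
Hypothesis e_L2 : forall k i, (k < N)%N -> (fun w => e k w i 0) \in Lfun P 2%:E.
Hypothesis e_indep : independent_vecs P N e.
Hypothesis Phi_sym : forall k, (k < N)%N -> (Phi k)^T = Phi k.
Hypothesis Phi_ge0 : forall k, (k < N)%N -> nonneg_definite (Phi k).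
Variable mu : nat -> R.
Hypothesis mu_gt0 : forall k, (k < N)%N -> 0 < mu k.

Local Notation Th := (Theta s e).
Local Notation l2k k := (l2 P (hist e k)).
Local Notation l2v k := (l2_vec P (hist e k)).
Local Notation E := (Ex P).
Local Notation mean := (mean P s e).
Local Notation gains := (total_gains N s e).
Local Notation a k := (accrual s k.+1 N).
Local Notation adm := (admissible P N e).
Local Notation Ups := (fun k => mu k *: block_mx (Phi k) (- Phi k) (- Phi k) (Phi k)).
Local Notation dev t z u := (deviation P N s e t z u).
Local Notation stationary_u := (stationary_u P N s e lam Phi mu).
Local Notation stationary_v := (stationary_v P N s e lam Phi mu).
Implicit Types (u v h : nat -> Omega -> 'cV[R]_p0) (z : Omega -> R).

Let histm k A : (k <= N)%N -> <<s hist e k >> A -> measurable A.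
Proof. by apply: hist_measurable => l i /(e_L2 i) /L2_measurable. Qed.

Let histT k : <<s hist e k >> setT.
Proof. exact: (@measurableT _ (g_sigma_algebraType _)). Qed.

Definition slot k (g : Omega -> 'cV[R]_p0) (l : nat) : Omega -> 'cV[R]_p0 :=
  if l == k then g else fun=> 0.

Lemma slot_adm t k g : (t <= k)%N -> l2v k g -> adm t (slot k g).
Proof.
by move=> tk hg l _; rewrite /slot; case: eqP => [->//|_]; exact: l2v_cst.
Qed.

Lemma sum_slot t k (F : nat -> R) : (t <= k < N)%N ->
  (forall l, l != k -> F l = 0) -> \sum_(t <= l < N) F l = F k.
Proof.
move=> tkN F0; rewrite (bigD1_seq k)/= ?iota_uniq ?mem_index_iota//.
by rewrite big1 ?addr0.
Qed.

Lemma gains_slot t k g w : (t <= k < N)%N ->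
  gains t (slot k g) w = a k * dot (Th k w) (g w).
Proof.
move=> tkN; rewrite /total_gains (sum_slot tkN) /slot ?eqxx// => l /negbTE ->.
by rewrite dot0r mulr0.
Qed.

Lemma gainsZ t r h w : gains t (fun l w => r *: h l w) w = r * gains t h w.
Proof. by rewrite /total_gains mulr_sumr; apply: eq_bigr => l _; rewrite dotZr mulrCA. Qed.

Lemma is_projZ k r (X H : Omega -> R) : L2 P X -> is_proj P (hist e k) X H ->
  is_proj P (hist e k) (fun w => r * X w) (fun w => r * H w).
Proof.
move=> LX [hH pH]; split => [|Y hY]; first exact: l2Z.
under eq_Ex do rewrite -mulrA.
under [RHS]eq_Ex do rewrite -mulrA.
rewrite !ExZ ?pH//; [exact: L1M (l2_L2 hH) (l2_L2 hY)|exact: L1M LX (l2_L2 hY)].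
Qed.

Lemma quad_ge0 t A h H : 0 <= quad P N s e Phi mu t A h H.
Proof.
have ind w : 0 <= \1_A w :> R by rewrite indicE.
rewrite addr_ge0//; last by apply: Ex_ge0 => w; rewrite mulr_ge0// sqr_ge0.
rewrite big_nat sumr_ge0// => k /andP[_ kN].
rewrite mulr_ge0 ?(ltW (mu_gt0 kN))//; apply: Ex_ge0 => w.
by rewrite mulr_ge0// -qform_dot; exact: Phi_ge0.
Qed.

Section FixedTime.
Variables (t : nat) (z : Omega -> R).
Hypotheses (tN : (t <= N)%N) (hz : l2k t z).

Local Notation Jh := (Jhat P N s e lam Ups t z).

(** Varying [u] by [r *: g] at the single time [k] changes the expected cost by
    [r ^+ 2 * Q + 2 * (r * L)] with [Q] nonnegative; this is nonnegative for all real [r] only if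
    [L = 0]. The whole space suffices as test event, since [g] is arbitrary. *)
Lemma minimizer_stationary u v : adm t u -> adm t v ->
  (forall u', adm t u' -> {ae P, forall w, Jh u v w <= Jh u' v w}) ->
  forall k g, (t <= k < N)%N -> l2v k g ->
  mu k * E (fun w => dot (g w) (Phi k *m (u k w - v k w)))
  + a k * E (fun w => dev t z u w * dot (Th k w) (g w))
  - lam / 2 * a k * E (fun w => dot (Th k w) (g w)) = 0.
Proof.
move=> hu hv umin k g tkN hg; have /andP[tk kN] := tkN.
set L := (X in X = 0).
have hh := slot_adm tk hg; have Lg := gains_L2 s e_L2 e_indep tN hh.
have pH : is_proj P (hist e t) (gains t (slot k g)) _ :=
  EtP e_L2 tN Lg.
set H := condexp _ _ _ in pH.
pose h r l w : 'cV[R]_p0 := r *: slot k g l w.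
have hr r : adm t (h r) by move=> l tlN; apply: l2vZ; exact: hh.
(* Scaling one fixed version of the projection makes the quadratic part exactly homogeneous in
   [r]. *)
have pHr r : is_proj P (hist e t) (gains t (h r)) (fun w => r * H w).
  rewrite (_ : gains t (h r) = fun w => r * gains t (slot k g) w).
    exact: is_projZ.
  by apply/funext => w; exact: gainsZ.
have linE r : lin_u P N s e lam Phi mu t z setT u v (h r) = r * L.
  rewrite /lin_u (sum_slot tkN) => [|l /negbTE lk].
    rewrite /h /slot eqxx.
    under eq_Ex do rewrite indicT scale1r dotZl.
    under [X in _ + _ * X]eq_Ex do rewrite indicT scale1r dotZr mulrCA.
    under [X in _ - _ * X]eq_Ex do rewrite indicT scale1r dotZr.
    have LT := l2_L2 (l2_dot_Theta s e_L2 e_indep kN hg).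
    have La : L1 P (fun w => dot (g w) (Phi k *m (u k w - v k w))).
      by apply: (L1_dot hg); apply: l2v_mul; apply: l2vB; [exact: hu|exact: hv].
    have Lb := L1M (deviation_L2 s e_L2 e_indep tN hz hu) LT.
    by rewrite !ExZ//; [rewrite /L; ring|exact: L2_L1].
  rewrite /h /slot lk.
  have z0 (F : Omega -> R) : (forall w, F w = 0) -> E F = 0.
    by move=> F0; rewrite -[RHS](Ex_cst P 0); exact: eq_Ex.
  rewrite !z0 ?mulr0 ?addr0 ?subr0// => w; rewrite !scaler0 ?dot0r ?mulr0//.
  by rewrite dotC dot0r.
have quadE r : quad P N s e Phi mu t setT (h r) (fun w => r * H w) =
   r ^+ 2 * quad P N s e Phi mu t setT (slot k g) H.
  rewrite /quad mulrDr mulr_sumr; congr (_ + _).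
    apply: eq_big_nat => l tlN; rewrite mulrCA; congr (_ * _).
    rewrite -ExZ; last first.
      apply: L1_indicM; first exact: measurableT.
      by apply: (L1_dot (hh l tlN)); apply: l2v_mul; exact: hh.
    by apply: eq_Ex => w; rewrite /h -scalemxAr dotZr dotZl; ring.
  rewrite -ExZ; last first.
    apply: L1_indicM; first exact: measurableT.
    by apply: L1M; apply: L2B => //; exact: l2_L2 pH.1.
  by apply: eq_Ex => w; rewrite (gainsZ t r (slot k g)); ring.
apply: (linear_coef_eq0 (quad_ge0 t setT (slot k g) H)) => r.
have hur : adm t (fun l w => u l w + h r l w).
  by move=> l tlN; apply: l2vD; [exact: hu|exact: hr].
have [_ Lu _] := Jhat_condexp s lam Phi e_L2 e_indep mu tN hz hu hv.
have [_ Lur _] := Jhat_condexp s lam Phi e_L2 e_indep mu tN hz hur hv.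
have := Jhat_expansion lam e_L2 e_indep Phi_sym mu tN hz hu hv (hr r) (pHr r) (@histT t).
under eq_Ex do rewrite indicT mul1r.
under [X in _ = X + _ + _ -> _]eq_Ex do rewrite indicT mul1r.
rewrite quadE linE => Eq.
have := le_Ex_ae Lu Lur (umin _ hur).
by rewrite Eq -addrA lerDl.
Qed.

(** On every event of the past of [t] the linear part vanishes by stationarity in the localized
    direction, and the quadratic part is nonnegative; [wrt_ge0_ae] makes the inequality almost
    sure. *)
Lemma stationary_minimizer u v : adm t u -> adm t v ->
  (forall k g, (t <= k < N)%N -> l2v k g ->
    mu k * E (fun w => dot (g w) (Phi k *m (u k w - v k w)))
    + a k * E (fun w => dev t z u w * dot (Th k w) (g w))
    - lam / 2 * a k * E (fun w => dot (Th k w) (g w)) = 0) ->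
  forall u', adm t u' -> {ae P, forall w, Jh u v w <= Jh u' v w}.
Proof.
move=> hu hv st u' hu'.
pose h l w : 'cV[R]_p0 := u' l w - u l w.
have hh : adm t h by move=> l tlN; apply: l2vB; [exact: hu'|exact: hu].
have uh : (fun l w => u l w + h l w) = u'.
  by apply/funext => l; apply/funext => w; rewrite /h addrC subrK.
have [m1 Lu _] := Jhat_condexp s lam Phi e_L2 e_indep mu tN hz hu hv.
have [m2 Lu' _] := Jhat_condexp s lam Phi e_L2 e_indep mu tN hz hu' hv.
have Lg := gains_L2 s e_L2 e_indep tN hh.
have pH := EtP e_L2 tN Lg.
have sG A : <<s hist e t >> A -> measurable A by exact: histm.
have : {ae P, forall w, 0 <= Jh u' v w - Jh u v w}.
  apply: (wrt_ge0_ae sG); [exact: measurable_funB|exact: L1B|].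
  move=> A sA; have mA := sG _ sA.
  have Lu1 := L1_indicM mA Lu; have Lu2 := L1_indicM mA Lu'.
  have -> : E (fun w => \1_A w * (Jh u' v w - Jh u v w)) =
      E (fun w => \1_A w * Jh u' v w) - E (fun w => \1_A w * Jh u v w).
    by rewrite -ExB//; apply: eq_Ex => w; rewrite mulrBr.
  rewrite -uh (Jhat_expansion lam e_L2 e_indep Phi_sym mu tN hz hu hv hh pH sA).
  rewrite [lin_u _ _ _ _ _ _ _ _ _ _ _ _ _](_ : _ = 0).
    by rewrite mulr0 addr0 addrAC subrr add0r; exact: quad_ge0.
  rewrite /lin_u; apply: big1_seq => k /=; rewrite mem_index_iota => tkN.
  apply: (st k (fun w => \1_A w *: h k w)) => //; have /andP[tk kN] := tkN.
  apply: (l2v_indic e_L2 (ltnW kN)) (hh _ tkN).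
  by apply: gen_vecS sA => l /= /leq_trans; apply.
by apply: filterS => w; rewrite subr_ge0.
Qed.

End FixedTime.

End Minimizers.

(** * The optimization over [v_k] by the self at time [k] *)

Section SelfTargets.
Context {R : realType} {d : measure_display} {Omega : measurableType d}.
Variable P : probability Omega R.
Variables (N p0 : nat) (s : nat -> R) (e : nat -> Omega -> 'cV[R]_p0) (lam : R).
Variable Phi : nat -> 'M[R]_p0.
Hypothesis e_L2 : forall k i, (k < N)%N -> (fun w => e k w i 0) \in Lfun P 2%:E.
Hypothesis e_indep : independent_vecs P N e.
Hypothesis Phi_sym : forall k, (k < N)%N -> (Phi k)^T = Phi k.
Hypothesis Phi_ge0 : forall k, (k < N)%N -> nonneg_definite (Phi k).
Variable mu : nat -> R.
Hypothesis mu_gt0 : forall k, (k < N)%N -> 0 < mu k.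

Local Notation Th := (Theta s e).
Local Notation l2k k := (l2 P (hist e k)).
Local Notation l2v k := (l2_vec P (hist e k)).
Local Notation E := (Ex P).
Local Notation mean := (mean P s e).
Local Notation gains := (total_gains N s e).
Local Notation a k := (accrual s k.+1 N).
Local Notation adm := (admissible P N e).
Local Notation Ups := (fun k => mu k *: block_mx (Phi k) (- Phi k) (- Phi k) (Phi k)).
Local Notation dev t z u := (deviation P N s e t z u).
Local Notation stationary_u := (stationary_u P N s e lam Phi mu).
Local Notation stationary_v := (stationary_v P N s e lam Phi mu).
Implicit Types (u v h : nat -> Omega -> 'cV[R]_p0) (z : Omega -> R).

Let histm k A : (k <= N)%N -> <<s hist e k >> A -> measurable A.
Proof. by apply: hist_measurable => l i /(e_L2 i) /L2_measurable. Qed.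

Let histT k : <<s hist e k >> setT.
Proof. exact: (@measurableT _ (g_sigma_algebraType _)). Qed.

Section FixedTime.
Variables (k : nat) (x : Omega -> R) (u : nat -> Omega -> 'cV[R]_p0).
Hypotheses (kN : (k < N)%N) (hx : l2k k x) (hu : l2v k (u k)).

Local Notation Jb := (Jbar P N s e lam Ups k x u).
Let kN' : (k <= N)%N := ltnW kN.
Let sG A : <<s hist e k >> A -> measurable A := @histm k A kN'.
Let kkN : (k <= k < N)%N.
Proof. by rewrite leqnn. Qed.

(** In [Jbar] the penalty is not conditioned, being known at time [k]; its measurability therefore
    needs a proof of its own. *)
Lemma penalty_wrt v : l2v k (v k) -> measurable_wrt (hist e k) (penalty Ups u v k).
Proof.
move=> hv; rewrite (_ : penalty _ _ _ _ =
  fun w => mu k * dot (u k w - v k w) (Phi k *m (u k w - v k w))).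
  apply: measurable_funM; first exact: measurable_cst.
  under eq_fun do rewrite dotE.
  have h1 := l2vB hu hv; have h2 := l2v_mul (Phi k) h1.
  by apply: measurable_sum => i; apply: measurable_funM; [case: (h1 i)|case: (h2 i)].
by apply/funext => w; rewrite penaltyE.
Qed.

Lemma Jbar_condexp v : adm k v ->
  [/\ measurable_wrt (hist e k) (Jb v), L1 P (Jb v) &
  forall A, <<s hist e k >> A -> E (fun w => \1_A w * Jb v w) =
    E (fun w => \1_A w * penalty Ups u v k w) +
    E (fun w => \1_A w * J P N s e lam k x v w)].
Proof.
move=> hv; have hvk := hv k kkN.
have [mJ LJ _] := J_condexp s lam e_L2 e_indep kN' hx hv.
have Lp := penalty_L1 Phi mu hu hvk.
split; [by apply: measurable_funD => //; exact: penalty_wrt|exact: L1D|].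
move=> A sA; have mA := sG sA.
rewrite -ExD; [|exact: L1_indicM|exact: L1_indicM].
by apply: eq_Ex => w; rewrite /Jbar mulrDr.
Qed.

(** Two orthogonalities: the deviation is orthogonal to the past, so the mean of the return can be
    subtracted from the test function; the fluctuation obtained is orthogonal to the past, so the
    deviation can be replaced by the gains, from which it differs by the past variable [Y]. This
    removes the wealth [x] from the condition. *)
Lemma deviation_dot_Theta v g : adm k v -> l2v k g ->
  E (fun w => dev k x v w * dot (Th k w) (g w)) =
  E (fun w => gains k v w * (dot (Th k w) (g w) - dot (mean k) (g w))).
Proof.
move=> hv hg.
have Ld := deviation_L2 s e_L2 e_indep kN' hx hv.
have Lg := gains_L2 s e_L2 e_indep kN' hv.
have hT := l2_L2 (l2_dot_Theta s e_L2 e_indep kN hg).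
have hm := l2_dot_cst (mean k) hg.
have hD : L2 P (fun w => dot (Th k w) (g w) - dot (mean k) (g w)).
  by apply: L2B => //; exact: l2_L2 hm.
have LW := W_L2 s e_L2 e_indep kN' hx hv.
have [hE _] := EtP e_L2 kN' LW.
transitivity (E (fun w => dev k x v w * (dot (Th k w) (g w) - dot (mean k) (g w))
    + dev k x v w * dot (mean k) (g w))).
  by apply: eq_Ex => w; ring.
rewrite ExD ?(deviation_orth s e_L2 e_indep kN' hx hv hm) ?addr0; last 2 first.
- exact: L1M Ld hD.
- exact: L1M Ld (l2_L2 hm).
set Y := fun w => accrual s k N * x w - condexp P (hist e k) (wealth s e k x v N) w.
have hY : l2k k Y by apply: l2B => //; exact: l2Z.
transitivity (E (fun w => Y w * (dot (Th k w) (g w) - dot (mean k) (g w)) +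
   gains k v w * (dot (Th k w) (g w) - dot (mean k) (g w)))).
  by apply: eq_Ex => w; rewrite /deviation wealth_gains// /Y; ring.
rewrite ExD; last 2 first.
- exact: L1M (l2_L2 hY) hD.
- exact: L1M Lg hD.
by rewrite (Ex_dev1 s e_L2 e_indep kN hg hY) add0r.
Qed.

Lemma replace_slot v g : replace_at v k (fun w => v k w + g w) =
  fun l w => v l w + slot k g l w.
Proof.
apply/funext => l; apply/funext => w; rewrite /replace_at /slot.
by case: eqP => [->//|_]; rewrite addr0.
Qed.

Lemma Jbar_expansion v g H A : adm k v -> l2v k g ->
  is_proj P (hist e k) (gains k (slot k g)) H -> <<s hist e k >> A ->
  E (fun w => \1_A w * Jb (replace_at v k (fun w => v k w + g w)) w) =
  E (fun w => \1_A w * Jb v w) +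
  (mu k * E (fun w => \1_A w * dot (g w) (Phi k *m g w)) +
   E (fun w => \1_A w * (gains k (slot k g) w - H w) ^+ 2)) +
  2 * (mu k * E (fun w => dot (\1_A w *: g w) (Phi k *m (v k w - u k w)))
     + a k * E (fun w => gains k v w *
         (dot (Th k w) (\1_A w *: g w) - dot (mean k) (\1_A w *: g w)))
     - lam / 2 * a k * E (fun w => dot (Th k w) (\1_A w *: g w))).
Proof.
move=> hv hg pH sA; have hh : adm k (slot k g) := slot_adm (leqnn k) hg; have hvk := hv k kkN.
have hvh : adm k (fun l w => v l w + slot k g l w).
  move=> l hl; apply: l2vD; first exact: hv. exact: (hh l hl).
have hgA : l2v k (fun w => \1_A w *: g w) by apply: (l2v_indic e_L2 kN').
rewrite replace_slot.
have [_ _ ->//] := Jbar_condexp hvh; have [_ _ ->//] := Jbar_condexp hv.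
rewrite (J_expansion lam e_L2 e_indep kN' hx hv hh pH sA).
have LT := l2_L2 (l2_dot_Theta s e_L2 e_indep kN hgA).
have Ld := deviation_L2 s e_L2 e_indep kN' hx hv.
have gE w : \1_A w * gains k (slot k g) w = a k * dot (Th k w) (\1_A w *: g w).
  by rewrite (gains_slot s e g w kkN) dotZr mulrCA.
have -> : E (fun w => dev k x v w * (\1_A w * gains k (slot k g) w)) =
  a k * E (fun w => gains k v w *
         (dot (Th k w) (\1_A w *: g w) - dot (mean k) (\1_A w *: g w))).
  rewrite -(deviation_dot_Theta hv hgA) -ExZ; last exact: L1M Ld LT.
  by apply: eq_Ex => w; rewrite gE mulrCA.
have -> : E (fun w => \1_A w * gains k (slot k g) w) =
   a k * E (fun w => dot (Th k w) (\1_A w *: g w)).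
  by rewrite -ExZ; [apply: eq_Ex|exact: L2_L1].
(* The penalty is even in [u - v]; it is rewritten in [v - u] because here [v] is the variable. *)
have -> : E (fun w => \1_A w * penalty Ups u (fun l w => v l w + slot k g l w) k w) =
  E (fun w => \1_A w * (mu k * dot ((v k w - u k w) + g w) (Phi k *m ((v k w - u k w) + g w)))).
  apply: eq_Ex => w; rewrite penaltyE /slot eqxx; congr (_ * (_ * _)).
  rewrite -[u k w - _]opprB addrAC mulmxN dotNr -dotC dotNr opprK dotC.
  by [].
have -> : E (fun w => \1_A w * penalty Ups u v k w) =
  E (fun w => \1_A w * (mu k * dot (v k w - u k w) (Phi k *m (v k w - u k w)))).
  apply: eq_Ex => w; rewrite penaltyE; congr (_ * (_ * _)).
  rewrite -[u k w - _]opprB mulmxN dotNr -dotC dotNr opprK dotC.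
  by [].
rewrite (penalty_expand e_L2 Phi_sym mu kN sA (l2vB hvk hu) hg).
by field.
Qed.

Let quad1 (A : set Omega) g (H : Omega -> R) : R :=
  mu k * E (fun w => \1_A w * dot (g w) (Phi k *m g w)) +
  E (fun w => \1_A w * (gains k (slot k g) w - H w) ^+ 2).

Let quad1_ge0 A g H : 0 <= quad1 A g H.
Proof.
have ind w : 0 <= \1_A w :> R by rewrite indicE.
rewrite addr_ge0//; last by apply: Ex_ge0 => w; rewrite mulr_ge0// sqr_ge0.
rewrite mulr_ge0 ?(ltW (mu_gt0 kN))//; apply: Ex_ge0 => w.
by rewrite mulr_ge0// -qform_dot; exact: Phi_ge0.
Qed.

(** The variational argument used for [u], applied to the replacement values [v k w + r *: g w]. *)
Lemma Jbar_minimizer_stationary v : adm k v ->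
  (forall g, l2v k g -> {ae P, forall w, Jb v w <= Jb (replace_at v k g) w}) ->
  stationary_v u v k.
Proof.
move=> hv vmin g hg; have hvk := hv k kkN.
set L := (X in X = 0).
have hh : adm k (slot k g) := slot_adm (leqnn k) hg.
have Lg := gains_L2 s e_L2 e_indep kN' hh.
have pH := EtP e_L2 kN' Lg; set H := condexp _ _ _ in pH.
have gZ r w : gains k (slot k (fun w => r *: g w)) w = r * gains k (slot k g) w.
  by rewrite !(gains_slot s e _ w kkN) dotZr mulrCA.
have hr r : l2v k (fun w => r *: g w) by exact: l2vZ.
have pHr r : is_proj P (hist e k) (gains k (slot k (fun w => r *: g w))) (fun w => r * H w).
  rewrite (_ : gains k _ = fun w => r * gains k (slot k g) w); first exact: is_projZ.
  by apply/funext => w; exact: gZ.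
have quadE r : quad1 setT (fun w => r *: g w) (fun w => r * H w) = r ^+ 2 * quad1 setT g H.
  rewrite /quad1 mulrDr mulrCA; congr (_ * _ + _).
    rewrite -ExZ; last first.
      apply: L1_indicM; first exact: measurableT.
      by apply: (L1_dot hg); exact: l2v_mul.
    by apply: eq_Ex => w; rewrite -scalemxAr dotZr dotZl; ring.
  rewrite -ExZ; last first.
    apply: L1_indicM; first exact: measurableT.
    by apply: L1M; apply: L2B => //; exact: l2_L2 pH.1.
  by apply: eq_Ex => w; rewrite gZ; ring.
apply: (linear_coef_eq0 (quad1_ge0 setT g H)) => r.
have hvr : adm k (replace_at v k (fun w => v k w + r *: g w)).
  rewrite replace_slot => l hl; apply: l2vD; first exact: hv.
  have hs : adm k (slot k (fun w => r *: g w)) := slot_adm (leqnn k) (hr r).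
  exact: hs.
have [_ Lv _] := Jbar_condexp hv.
have [_ Lvr _] := Jbar_condexp hvr.
have := Jbar_expansion hv (hr r) (pHr r) (@histT k).
under eq_Ex do rewrite indicT mul1r.
under [X in _ = X + _ + _ -> _]eq_Ex do rewrite indicT mul1r.
rewrite -/(quad1 setT (fun w => r *: g w) (fun w => r * H w)) quadE.
rewrite [X in 2 * X](_ : _ = r * L) => [Eq|].
  have hvr' : l2v k (fun w => v k w + r *: g w) by exact: l2vD.
  have := le_Ex_ae Lv Lvr (vmin _ hvr').
  by rewrite Eq -addrA lerDl.
have LT := l2_dot_Theta s e_L2 e_indep kN hg.
have hm := l2_histS (leqnSn k) (l2_dot_cst (mean k) hg).
have La : L1 P (fun w => dot (g w) (Phi k *m (v k w - u k w))).
  by apply: (L1_dot hg); apply: l2v_mul; exact: l2vB.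
have Lb : L1 P (fun w => gains k v w * (dot (Th k w) (g w) - dot (mean k) (g w))).
  exact: (L1M (gains_L2 s e_L2 e_indep kN' hv) (l2_L2 (l2B LT hm))).
under eq_Ex do rewrite indicT scale1r dotZl.
under [X in _ + _ * X]eq_Ex do rewrite indicT scale1r !dotZr -mulrBr mulrCA.
under [X in _ - _ * X]eq_Ex do rewrite indicT scale1r dotZr.
by rewrite !ExZ//; [rewrite /L; ring|exact: L2_L1 (l2_L2 LT)].
Qed.

Lemma stationary_Jbar_minimizer v : adm k v -> stationary_v u v k ->
  forall g, l2v k g -> {ae P, forall w, Jb v w <= Jb (replace_at v k g) w}.
Proof.
move=> hv st g hg; have hvk := hv k kkN.
pose h w : 'cV[R]_p0 := g w - v k w.
have hh : l2v k h by exact: l2vB.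
have gE : g = fun w => v k w + h w by apply/funext => w; rewrite /h addrC subrK.
have hs : adm k (slot k h) := slot_adm (leqnn k) hh.
have hvg : adm k (replace_at v k g).
  by rewrite gE replace_slot => l hl; apply: l2vD; [exact: hv|exact: hs].
have [m1 Lv _] := Jbar_condexp hv.
have [m2 Lv' _] := Jbar_condexp hvg.
have Lg := gains_L2 s e_L2 e_indep kN' hs.
have pH := EtP e_L2 kN' Lg.
have : {ae P, forall w, 0 <= Jb (replace_at v k g) w - Jb v w}.
  apply: (wrt_ge0_ae sG); [exact: measurable_funB|exact: L1B|].
  move=> A sA; have mA := sG sA.
  have Lu1 := L1_indicM mA Lv; have Lu2 := L1_indicM mA Lv'.
  have -> : E (fun w => \1_A w * (Jb (replace_at v k g) w - Jb v w)) =
      E (fun w => \1_A w * Jb (replace_at v k g) w) - E (fun w => \1_A w * Jb v w).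
    by rewrite -ExB//; apply: eq_Ex => w; rewrite mulrBr.
  rewrite gE (Jbar_expansion hv hh pH sA) (st (fun w => \1_A w *: h w)).
    by rewrite mulr0 addr0 addrAC subrr add0r; exact: quad1_ge0.
  exact: (l2v_indic e_L2 kN').
by apply: filterS => w; rewrite subr_ge0.
Qed.

End FixedTime.

End SelfTargets.

Lemma finite_set_negligible (R : realType) (A : set R) : finite_set A ->
  (@lebesgue_measure R).-negligible A.
Proof.
move=> finA; have cA := finite_set_countable finA.
exists A; split => //; last exact: countable_lebesgue_measure0.
exact: countable_measurable.
Qed.

(** * Existence and uniqueness for regular parameters, and the exceptional sets *)

Section Equilibrium.
Context {R : realType} {d : measure_display} {Omega : measurableType d}.
Variable P : probability Omega R.
Variables (N p0 : nat) (s : nat -> R) (e : nat -> Omega -> 'cV[R]_p0) (lam : R).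
Variable Phi : nat -> 'M[R]_p0.
Hypothesis e_L2 : forall k i, (k < N)%N -> (fun w => e k w i 0) \in Lfun P 2%:E.
Hypothesis e_indep : independent_vecs P N e.
Hypothesis Phi_sym : forall k, (k < N)%N -> (Phi k)^T = Phi k.
Hypothesis Phi_ge0 : forall k, (k < N)%N -> nonneg_definite (Phi k).
Variable mu : nat -> R.
Hypothesis mu_gt0 : forall k, (k < N)%N -> 0 < mu k.

Local Notation Th := (Theta s e).
Local Notation l2k k := (l2 P (hist e k)).
Local Notation l2v k := (l2_vec P (hist e k)).
Local Notation E := (Ex P).
Local Notation gains := (total_gains N s e).
Local Notation a k := (accrual s k.+1 N).
Local Notation adm := (admissible P N e).
Local Notation Ups := (fun k => mu k *: block_mx (Phi k) (- Phi k) (- Phi k) (Phi k)).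
Local Notation dev t z u := (deviation P N s e t z u).
Local Notation cf k := (coefs P N s e lam Phi mu k).
Implicit Types (u v : nat -> Omega -> 'cV[R]_p0) (z : Omega -> R).

Hypothesis mu_reg : forall k, (k < N)%N ->
  regular (a k) (mean P s e k) (cov_mx P (e k)) (Phi k) (cf k.+1) (mu k).

Let histm k A : (k <= N)%N -> <<s hist e k >> A -> measurable A.
Proof. by apply: hist_measurable => l i /(e_L2 i) /L2_measurable. Qed.

Variables (t : nat) (z : Omega -> R).
Hypotheses (tN : (t <= N)%N) (hz : l2k t z) (rho_t : c_rho (cf t) != 0).

Let xi0 : R := - c_q (cf t) / c_rho (cf t).
(** The wealth [z] does not enter: the controls [u0] and [v0] depend only on the returns observed
    since time [t]. *)
Let xi := loop P N s e lam Phi mu t xi0.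
Let u0 k w := fb_u P N s e lam Phi mu k (xi k w).
Let v0 k w := fb_v P N s e lam Phi mu k (xi k w).

Let u0_adm : adm t u0.
Proof.
move=> k /andP[tk kN]; apply: l2v_fb_u.
exact: (loop_l2 s lam Phi e_L2 e_indep mu t xi0 (ltnW kN)).
Qed.

Let v0_adm : adm t v0.
Proof.
move=> k /andP[tk kN]; apply: l2v_fb_v.
exact: (loop_l2 s lam Phi e_L2 e_indep mu t xi0 (ltnW kN)).
Qed.

Let xi_t : l2k t (xi t).
Proof. exact: (loop_l2 s lam Phi e_L2 e_indep mu t xi0 tN). Qed.

Let xiS k : (t <= k < N)%N -> forall w,
  xi k.+1 w = xi k w + a k * dot (Th k w) (u0 k w).
Proof. by move=> /andP[tk _] w; exact: loopS. Qed.

Let fb k : (t <= k < N)%N -> feedback P N s e lam Phi mu u0 v0 xi k.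
Proof. by move=> _; apply: aeW. Qed.

Lemma self_coordination_exists : self_coordination P N s e lam Ups t z v0.
Proof.
have [st [proj_t _]] := feedback_stationary e_L2 e_indep mu_reg tN u0_adm v0_adm xi_t xiS fb.
have xiN w : xi N w = xi0 + gains t u0 w.
  have gen k : (t <= k <= N)%N ->
      xi k w = xi t w + \sum_(t <= l < k) a l * dot (Th l w) (u0 l w).
    elim: k => [|k ih] /andP[tk kN].
      by move: tk; rewrite leqn0 => /eqP ->; rewrite big_geq// addr0.
    move: tk; rewrite leq_eqVlt => /predU1P[->|tk]; first by rewrite big_geq// addr0.
    rewrite big_nat_recr//= xiS ?kN ?andbT// ih ?addrA//.
    by rewrite (ltnW kN) andbT.
  by rewrite gen ?tN ?leqnn// {1}/xi loop_init.
(* The choice of [xi0] is [rho_t * xi0 + q_t = 0], which makes the projection of [xi N] on the past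
   of [t] vanish. *)
have orth Y : l2k t Y -> E (fun w => xi N w * Y w) = 0.
  move=> hY; rewrite proj_t// -[RHS](Ex_cst P 0); apply: eq_Ex => w.
  by rewrite /xi loop_init /xi0 mulrC mulrCA mulfV// mulr1 addNr mulr0.
have hxiN : L2 P (xi N).
  exact: l2_L2 (loop_l2 s lam Phi e_L2 e_indep mu t xi0 (leqnn N)).
have LW := W_L2 s e_L2 e_indep tN hz u0_adm.
(* Consistency: the terminal wealth is [accrual s t N * z - xi0] plus [xi N], and the latter has
   projection zero. Hence the process built from the guess [xi0] ends at the true deviation of the
   wealth under [u0]. *)
have pW : is_proj P (hist e t) (wealth s e t z u0 N) (fun w => accrual s t N * z w - xi0).
  have hA : l2k t (fun w => accrual s t N * z w - xi0) by apply: l2B; [exact: l2Z|exact: l2_cst].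
  split => // Y hY.
  transitivity (E (fun w => (accrual s t N * z w - xi0) * Y w + xi N w * Y w)).
    by apply: eq_Ex => w; rewrite wealth_gains// xiN; ring.
  rewrite ExD ?orth ?addr0//; [exact: L1M (l2_L2 hA) (l2_L2 hY)|exact: L1M hxiN (l2_L2 hY)].
have aeE := is_proj_ae LW (EtP e_L2 tN LW) pW.
have Ld := deviation_L2 s e_L2 e_indep tN hz u0_adm.
have aedev : {ae P, forall w, dev t z u0 w = xi N w}.
  by apply: filterS aeE => w; rewrite /deviation wealth_gains// => ->; rewrite xiN; ring.
split => //; exists u0; split => //.
- apply: (stationary_minimizer e_L2 e_indep Phi_sym Phi_ge0 mu_gt0 tN hz u0_adm v0_adm).
  move=> k g tkN hg; have /andP[tk kN] := tkN.
  have [su _] := st k tkN; rewrite -(su g hg); congr (_ + _ * _ - _).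
  have LT := l2_L2 (l2_dot_Theta s e_L2 e_indep kN hg).
  apply: ae_Ex; [exact: L1_measurable (L1M Ld LT)|exact: L1_measurable (L1M hxiN LT)|].
  by apply: filterS aedev => w ->.
- move=> k vk tkN hvk; have /andP[tk kN] := tkN.
  have [_ sv] := st k tkN.
  apply: (stationary_Jbar_minimizer e_L2 e_indep Phi_sym Phi_ge0 mu_gt0 kN) => //.
  + by apply: (wealth_l2 s e_L2 e_indep) => //; rewrite tk ltnW.
  + exact: u0_adm.
  + by move=> j /andP[kj jN]; apply: v0_adm; rewrite (leq_trans tk kj).
Qed.

Lemma self_coordination_unique v : self_coordination P N s e lam Ups t z v ->
  forall k, (t <= k < N)%N -> {ae P, forall w, v k w = v0 k w}.
Proof.
move=> [hv [u [hu umin vmin]]].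
(* The same conditional mean, at time [t], is subtracted for all [k], so the riskless growth cancels
   in the increments and [xi' N] is the deviation. *)
pose xi' k w := accrual s k N * wealth s e t z u k w -
  condexp P (hist e t) (wealth s e t z u N) w.
have accS k : (k < N)%N -> accrual s k N = s k * a k.
  by move=> kN; rewrite /accrual big_ltn.
have xi'S k : (t <= k < N)%N -> forall w,
    xi' k.+1 w = xi' k w + a k * dot (Th k w) (u k w).
  by move=> /andP[tk kN] w; rewrite /xi' /= tk (accS _ kN) -/(dot _ _); ring.
have LW := W_L2 s e_L2 e_indep tN hz hu.
have xi'N : xi' N = dev t z u.
  by apply/funext => w; rewrite /xi' /deviation /accrual big_geq// mul1r.
have xi'_t : l2k t (xi' t).
  apply: l2B; last exact: (EtP e_L2 tN LW).1.
  by apply: l2Z; apply: (wealth_l2 s e_L2 e_indep) => //; rewrite leqnn.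
have st k : (t <= k < N)%N ->
    stationary_u P N s e lam Phi mu u v xi' k /\ stationary_v P N s e lam Phi mu u v k.
  move=> tkN; have /andP[tk kN] := tkN; split.
    move=> g hg; rewrite xi'N.
    exact: (minimizer_stationary e_L2 e_indep Phi_sym Phi_ge0 mu_gt0 tN hz hu hv umin).
  apply: (Jbar_minimizer_stationary e_L2 e_indep Phi_sym Phi_ge0 mu_gt0 kN
    (x := wealth s e t z v k)).
  - by apply: (wealth_l2 s e_L2 e_indep) => //; rewrite tk ltnW.
  - exact: hu.
  - by move=> j /andP[kj jN]; apply: hv; rewrite (leq_trans tk kj).
  - by move=> g hg; exact: vmin.
have fb' := stationary_feedback e_L2 e_indep mu_reg tN hu hv xi'_t xi'S st.
have [[proj_t _] _] := fb' t (introT andP (conj (leqnn t) tN)).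
have xx : {ae P, forall w, xi' t w = xi t w}.
  (* The left-hand side is the projection of the deviation on the past of [t], which is zero.
     Dividing by [rho_t] shows that any solution starts from [xi0]. *)
  have h0 : {ae P, forall w, c_rho (cf t) * xi' t w + c_q (cf t) = 0}.
    apply: (@l2_eq0 _ _ _ P (hist e t)).
      by apply: l2D; [exact: l2Z|exact: l2_cst].
    move=> Y hY; rewrite -proj_t// xi'N.
    exact: (deviation_orth s e_L2 e_indep tN hz hu hY).
  apply: filterS h0 => w /eqP; rewrite addr_eq0 => /eqP h.
  by rewrite /xi loop_init /xi0 -h mulrAC mulfV// mul1r.
apply: (feedback_unique xi'S xiS _ fb xx) => k tkN; have /andP[tk kN] := tkN.
by have [_] := fb' k (introT andP (conj tk (ltnW kN))); exact.
Qed.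

End Equilibrium.

Theorem theorem3p3 (R : realType) (d : measure_display)
    (Omega : measurableType d) (P : probability Omega R)
    (N p0 : nat) (s : nat -> R) (e : nat -> Omega -> 'cV[R]_p0)
    (lam : R) (Phi : nat -> 'M[R]_p0)
    (N_ge1 : (1 <= N)%N)
    (s_gt1 : forall k, (k < N)%N -> 1 < s k)
    (e_L2 : forall k i, (k < N)%N -> (fun w => e k w i 0) \in Lfun P 2%:E)
    (e_indep : independent_vecs P N e)
    (e_cov : forall k, (k < N)%N -> pos_definite (cov_mx P (e k)))
    (lam_gt0 : 0 < lam)
    (Phi_sym : forall k, (k < N)%N -> (Phi k)^T = Phi k)
    (Phi_ge0 : forall k, (k < N)%N -> nonneg_definite (Phi k)) :
  sequently_generic N (fun mu : nat -> R =>
    forall (t : nat) (z : Omega -> R), (t < N)%N -> l2 P (hist e t) z ->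
      let Ups := fun k =>
        mu k *: block_mx (Phi k) (- Phi k) (- Phi k) (Phi k) in
      exists v : nat -> Omega -> 'cV[R]_p0,
        self_coordination P N s e lam Ups t z v /\
        (forall v' : nat -> Omega -> 'cV[R]_p0,
           self_coordination P N s e lam Ups t z v' ->
           forall k, (t <= k < N)%N -> {ae P, forall w, v' k w = v k w})).
Proof.
pose a k := accrual s k.+1 N; pose cf := coefs P N s e lam Phi.
have a_neq0 k : a k != 0.
  rewrite gt_eqF// /a /accrual big_nat; apply: prodr_gt0 => j /andP[_ jN].
  exact: lt_trans ltr01 (s_gt1 _ jN).
pose reg k mu := regular (a k) (mean P s e k) (cov_mx P (e k)) (Phi k) (cf mu k.+1).
(* Negligibility is required for every [mu], also when [c_rho (cf mu k.+1)] vanishes and irregular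
   values may be abundant; the first conjunct makes the set empty in that case. *)
exists (fun k mu => [set x | c_rho (cf mu k.+1) != 0 /\ ~ reg k mu x]); split.
- move=> k mu mu' kN mumu'; have E : cf mu k.+1 = cf mu' k.+1 by apply: eq_coefs.
  by rewrite /reg E.
- move=> k mu kN; apply: finite_set_negligible.
  have [rho0|rho_neq0] := eqVneq (c_rho (cf mu k.+1)) 0.
    by rewrite (_ : [set x | _] = set0)//; apply/seteqP; split => // x [].
  apply: sub_finite_set (irregular_finite (mean P s e k) (Phi k) (a_neq0 k) (e_cov _ kN) rho_neq0).
  by move=> x [].
move=> mu mu_ok t z tN hz Ups.
have mu_gt0 k : (k < N)%N -> 0 < mu k by move=> /mu_ok[].
(* For the chosen [mu] the first conjunct always holds: if [rho] is nonzero at [k.+1], avoiding the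
   exceptional set means regularity at [k], which in turn gives a nonzero [rho] at [k]. *)
have rho_neq0 k : (0 <= k <= N)%N -> c_rho (cf mu k) != 0.
  move: k; apply: backward_induction.
    by rewrite /cf coefsN/= oner_neq0.
  move=> k /andP[_ kN] rho1; rewrite /cf coefsS//; apply: (step_rho_neq0 _ (a_neq0 k) rho1).
  by apply: contrapT => nreg; have [_] := mu_ok k kN; apply; split.
have mu_reg k : (k < N)%N -> reg k mu (mu k).
  move=> kN; apply: contrapT => nreg; have [_] := mu_ok k kN.
  by apply; split => //; exact: rho_neq0.
have rho_t := rho_neq0 t (ltnW tN).
eexists; split; first exact: (self_coordination_exists e_L2 e_indep Phi_sym
  Phi_ge0 mu_gt0 mu_reg (ltnW tN) hz rho_t).
move=> v'; exact: (self_coordination_unique e_L2 e_indep Phi_sym Phi_ge0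
  mu_gt0 mu_reg (ltnW tN) hz rho_t).
Qed.
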